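(* $\pi(x) \sim \dfrac{x}{\log x}$ as $x \to \infty$; that is, $\displaystyle\lim_{x\to\infty} \frac{\pi(x)}{x/\log x} = 1$.
   Context: For real $x$, $\pi(x)$ denotes the number of prime numbers $p$ with $p \leq x$. $\log$ is the natural logarithm. For real-valued functions $f,g$ defined and nonzero for all sufficiently large $x$, $f(x)\sim g(x)$ means $\lim_{x\to\infty} f(x)/g(x) = 1$. *)

(* Defs.v *)
From HB Require Import structures.
From mathcomp Require Import all_boot all_order all_algebra finmap.
From mathcomp Require Import all_classical all_reals all_analysis.

Set Implicit Arguments.
Unset Strict Implicit.
Unset Printing Implicit Defensive.

Import Order.TTheory GRing.Theory Num.Theory.
Import numFieldNormedType.Exports.

Local Open Scope classical_set_scope.
Local Open Scope ring_scope.

Definition primes_le (R : realType) (x : R) : set nat :=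
  [set p | prime p /\ p%:R <= x].

(* [fset_set] is [fset0] on infinite sets; [finite_primes_le] below shows that
   this default value is never used. *)
Definition prime_pi (R : realType) (x : R) : nat :=
  #|` fset_set (primes_le x)|.

Lemma primes_le_truncn (R : realType) (x : R) (p : nat) :
  primes_le x p <-> prime p && (p <= Num.truncn x)%N.
Proof.
case: p => [|p]; first by split=> [[]|].
by rewrite truncn_gt_nat; split=> [[-> ->]|/andP[]].
Qed.

Lemma finite_primes_le (R : realType) (x : R) : finite_set (primes_le x).
Proof.
apply: (@sub_finite_set _ _ `I_(Num.truncn x).+1); last exact: finite_II.
by move=> p /primes_le_truncn/andP[].
Qed.

Lemma prime_piE (R : realType) (x : R) :
  prime_pi x = count prime (iota 0 (Num.truncn x).+1).
Proof.
rewrite /prime_pi -size_filter.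
have -> : fset_set (primes_le x) =
    [fset p in [seq p <- iota 0 (Num.truncn x).+1 | prime p]]%fset.
  apply/fsetP => p; rewrite in_fset_set; last exact: finite_primes_le.
  rewrite in_fset mem_filter mem_iota leq0n add0n ltnS.
  by apply/idP/idP => [/set_mem/primes_le_truncn//|?]; apply/mem_set/primes_le_truncn.
by rewrite card_fseq undup_id // filter_uniq // iota_uniq.
Qed.

(* Main.v *)
Require Import Defs.
From HB Require Import structures.
From mathcomp Require Import all_boot all_order all_algebra finmap.
From mathcomp Require Import all_classical all_reals all_analysis.
From mathcomp Require Import ring lra zify.

Import Order.TTheory GRing.Theory Num.Theory.
Import numFieldNormedType.Exports.

Local Open Scope classical_set_scope.
Local Open Scope ring_scope.

Set Implicit Arguments.
Unset Strict Implicit.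
Unset Printing Implicit Defensive.

(** The proof is the elementary one of Selberg and Erdos. Let [psi N] be the sum of von
    Mangoldt's function up to [N], and [psi_rem N = psi N - N]. Primes dominate prime
    powers, so the theorem follows from [psi_rem N = o(N)] ([psi_rem_o]) by
    [psi_le_primes] and [primes_le_psi].

    The starting point is Selberg's formula [selberg_rem],
      [psi_rem N * ln N + sum_(k <= N) mangoldt k * psi_rem (N / k) = O(N)].
    It comes from Moebius inversion with the weights [ln (N / n)], and needs no more
    than Stirling's formula and the asymptotics of the harmonic sum. Substituted into
    itself and averaged, it gives [psi_rem_average]:
      [|psi_rem N| (ln N)^2 <= 2 sum_(n <= N) |psi_rem (N / n)| ln n + O(N ln N)].

    Suppose that [|psi_rem n| <= alpha n] for large [n]. As the sum of [ln n / n] up to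
    [N] is about [(ln N)^2 / 2], this inequality only returns [alpha], unless the
    remainder is smaller than [alpha n] for a positive proportion of the [n], measured
    logarithmically. It is: Mertens' theorem bounds the sums of [psi_rem n / n ^ 2], so
    within every [[a, K a[] the remainder either is small somewhere or changes sign
    ([psi_rem_small_point]); and since Selberg's formula limits the growth of [psi] on
    short intervals ([psi_rem_short]), it is then small on an interval
    [z, (1 + e) z] ([psi_rem_small_interval]). Hence [alpha] can be lowered by an
    amount that depends only on a lower bound for [alpha] ([psi_rem_improve]), and
    repeating this brings it below any positive number.

    All sums run over naturals and the arguments of [psi] are the quotients [N %/ n],
    which compose exactly: [N %/ n %/ m = N %/ (n * m)]. *)

(** * Sums over divisors *)

Lemma sum_divisors_iota (V : nmodType) (k N : nat) (f : nat -> V) :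
  (0 < k <= N)%N ->
  \sum_(d <- divisors k) f d = \sum_(1 <= d < N.+1 | (d %| k)%N) f d.
Proof.
move=> /andP[k0 kN]; rewrite -[RHS]big_filter; apply: perm_big.
apply: uniq_perm; rewrite ?divisors_uniq ?filter_uniq ?iota_uniq// => d.
rewrite mem_filter mem_index_iota -dvdn_divisors//.
case: (boolP (d %| k)%N) => //= dk.
by rewrite (dvdn_gt0 k0 dk) ltnS (leq_trans (dvdn_leq k0 dk) kN).
Qed.

(** A pair of a [k <= N] and a divisor [d] of [k] is the same as a pair [(d, m)]
    with [d * m <= N]. *)
Lemma sum_divisors_exchange (V : nmodType) (N : nat) (f : nat -> nat -> V) :
  \sum_(1 <= k < N.+1) \sum_(d <- divisors k) f d (k %/ d)%N =
  \sum_(1 <= d < N.+1) \sum_(1 <= m < (N %/ d).+1) f d m.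
Proof.
rewrite big_nat.
under eq_bigr => k /andP[k1 kN].
  rewrite (@sum_divisors_iota _ _ N); last by rewrite k1.
  over.
rewrite -big_nat (exchange_big_dep_nat predT)//=.
apply: eq_big_nat => d /andP[d1 dN].
rewrite -big_filter.
have E : perm_eq [seq k <- index_iota 1 N.+1 | (d %| k)%N]
  (map (muln d) (index_iota 1 (N %/ d).+1)).
  apply: uniq_perm; rewrite ?filter_uniq ?iota_uniq//.
    rewrite map_inj_uniq ?iota_uniq// => x y /eqP.
    by rewrite eqn_pmul2l// => /eqP.
  move=> k; rewrite mem_filter mem_index_iota.
  apply/idP/mapP => [/andP[/dvdnP[m ->]] /andP[m1 m2]|[m]].
    exists m; last by rewrite mulnC.
    rewrite mem_index_iota; move: m1; rewrite muln_gt0 => /andP[-> _].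
    by rewrite ltnS leq_divRL.
  rewrite mem_index_iota ltnS leq_divRL// => /andP[m1 m2] ->.
  by rewrite dvdn_mulr// muln_gt0 d1 m1 ltnS mulnC m2.
rewrite (perm_big _ E) big_map; apply: eq_big_nat => m /andP[m1 _].
by rewrite mulKn.
Qed.

Lemma sum_divisors_primeM (V : nmodType) (p n : nat) (f : nat -> V) :
  prime p -> (0 < n)%N ->
  \sum_(d <- divisors (p * n)) f d =
  \sum_(d <- divisors n | ~~ (p %| d)%N) f d + \sum_(d <- divisors n) f (p * d)%N.
Proof.
move=> pp n0; have p0 := prime_gt0 pp.
have pn0 : (0 < p * n)%N by rewrite muln_gt0 p0.
rewrite (bigID (fun d => (p %| d)%N))/= addrC; congr (_ + _).
  rewrite -[LHS]big_filter -[RHS]big_filter; apply: perm_big.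
  apply: uniq_perm; rewrite ?filter_uniq ?divisors_uniq// => d.
  rewrite !mem_filter -!dvdn_divisors//; case: (boolP (p %| d)%N) => //= pd.
  by rewrite Gauss_dvdr// coprime_sym prime_coprime.
rewrite -[LHS]big_filter -[RHS](big_map (muln p) predT f); apply: perm_big.
apply: uniq_perm; rewrite ?filter_uniq ?divisors_uniq//.
  rewrite map_inj_uniq ?divisors_uniq// => x y /eqP.
  by rewrite eqn_pmul2l// => /eqP.
move=> d; rewrite !mem_filter -dvdn_divisors//.
apply/idP/mapP => [/andP[/dvdnP[m ->]]|[m]].
  rewrite mulnC dvdn_pmul2l// => mn.
  by exists m => //; rewrite -dvdn_divisors.
by rewrite -dvdn_divisors// => mn ->; rewrite dvdn_mulr//= dvdn_pmul2l.
Qed.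

(** * The functions of von Mangoldt and Moebius *)

(** Prime powers are the numbers with exactly one prime divisor. *)
Definition mangoldt (R : realType) (n : nat) : R :=
  if primes n is [:: p] then ln p%:R else 0.

(** The test says that [n] is squarefree. *)
Definition moebius (R : realType) (n : nat) : R :=
  if all (fun p => logn p n == 1%N) (primes n) then (-1) ^+ size (primes n)
  else 0.

Lemma ln_nat_ge0 (R : realType) (n : nat) : 0 <= ln n%:R :> R.
Proof. by case: n => [|n]; [rewrite ln0|apply: ln_ge0; rewrite ler1n]. Qed.

Lemma ler_ln_nat (R : realType) (m n : nat) :
  (0 < m)%N -> (m <= n)%N -> ln m%:R <= ln n%:R :> R.
Proof.
by move=> m0 mn; rewrite ler_ln ?ler_nat// posrE ltr0n// (leq_trans m0 mn).
Qed.

Lemma ln_natM (R : realType) (m n : nat) : (0 < m)%N -> (0 < n)%N ->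
  ln (m * n)%:R = ln m%:R + ln n%:R :> R.
Proof. by move=> m0 n0; rewrite natrM lnM// posrE ltr0n. Qed.

Lemma mangoldt_ge0 (R : realType) (n : nat) : 0 <= mangoldt R n.
Proof.
by rewrite /mangoldt; case: primes => [//|p [|//]]; apply: ln_nat_ge0.
Qed.

Lemma mangoldt_prime (R : realType) (p : nat) :
  prime p -> mangoldt R p = ln p%:R.
Proof. by move=> pp; rewrite /mangoldt primes_prime. Qed.

Lemma primes_seq1 (n p : nat) : primes n = [:: p] ->
  prime p /\ n = (p ^ logn p n)%N.
Proof.
move=> E; have : p \in primes n by rewrite E inE.
rewrite mem_primes => /and3P[pp n0 pn]; split=> //.
by rewrite [LHS]prod_prime_decomp// prime_decompE E big_map big_seq1.
Qed.

Lemma primes_expn (p k : nat) : prime p -> (0 < k)%N -> primes (p ^ k) = [:: p].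
Proof. by move=> pp k0; rewrite primesX// primes_prime. Qed.

(** A prime power that divides [p * m] but not [m] must contain one more factor
    [p] than [m] does. *)
Lemma mangoldt_new_divisor (R : realType) (p m d : nat) :
  prime p -> (0 < m)%N -> (d %| p * m)%N -> ~~ (d %| m)%N ->
  d != (p ^ (logn p m).+1)%N -> mangoldt R d = 0.
Proof.
move=> pp m0 dpm dm; rewrite /mangoldt.
case E: primes => [//|q [|//]] /eqP; case.
have [pq dE] := primes_seq1 E.
have qp : q = p.
  apply/eqP/negPn/negP => qp; move/negP: dm; apply.
  rewrite -(@Gauss_dvdr d p)// dE coprimeXl// prime_coprime//.
  by rewrite dvdn_prime2.
subst q; rewrite [LHS]dE; congr (_ ^ _)%N.
have k1 : (logn p d <= (logn p m).+1)%N.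
  have := dvdn_leq_log p _ dpm; rewrite muln_gt0 (prime_gt0 pp) m0 => /(_ isT).
  by rewrite lognM ?(prime_gt0 pp)// (logn_prime p pp) eqxx.
apply/eqP; rewrite eqn_leq k1/= ltnNge; apply: contra dm => k2.
by rewrite dE (dvdn_trans (dvdn_exp2l p k2))// pfactor_dvdnn.
Qed.

(** By induction on the number of prime factors: by [mangoldt_new_divisor],
    exactly one prime power, a power of [p], divides [p * m] and not [m]. *)
Lemma sum_mangoldt_divisors (R : realType) (n : nat) : (0 < n)%N ->
  \sum_(d <- divisors n) mangoldt R d = ln n%:R.
Proof.
elim/ltn_ind: n => n IH n0.
have [->|n1] := eqVneq n 1%N.
  by rewrite ln1 (_ : divisors 1 = [:: 1%N])// big_seq1.
have n2 : (1 < n)%N by case: n n1 {IH} n0 => [|[]].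
have pp := pdiv_prime n2; set p := pdiv n in pp.
have /dvdnP[m nE] := pdiv_dvd n; rewrite -/p mulnC in nE.
have m0 : (0 < m)%N by move: n0; rewrite nE muln_gt0 => /andP[].
have p0 := prime_gt0 pp.
have mn : (m < n)%N by rewrite nE ltn_Pmull// prime_gt1.
rewrite nE ln_natM// -(IH m)// (bigID (fun d => (d %| m)%N))/= addrC.
have pm0 : (0 < p * m)%N by rewrite -nE.
congr (_ + _).
  set P := (p ^ (logn p m).+1)%N.
  have Pd : P \in divisors (p * m).
    by rewrite -dvdn_divisors// /P expnS dvdn_pmul2l// pfactor_dvdnn.
  rewrite big_mkcond (big_rem P)//= {1}/P pfactor_dvdn// ltnn/=.
  rewrite [X in _ + X]big_seq big1 ?addr0 => [|d].
    by rewrite /mangoldt primes_expn.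
  rewrite mem_rem_uniq ?divisors_uniq// inE => /andP[dP].
  rewrite -dvdn_divisors// => dd; case: ifP => // nd.
    exact: mangoldt_new_divisor pp m0 dd nd dP.
rewrite -big_filter; apply: perm_big.
apply: uniq_perm; rewrite ?filter_uniq ?divisors_uniq// => d.
rewrite mem_filter -!dvdn_divisors//.
by case: (boolP (d %| m)%N) => //= dm; rewrite dvdn_mull.
Qed.

Lemma mangoldt_le_ln (R : realType) (n : nat) : mangoldt R n <= ln n%:R.
Proof.
case: n => [|n]; first by rewrite /mangoldt/= ln0.
rewrite -sum_mangoldt_divisors// (big_rem n.+1) ?divisors_id//= lerDl.
by apply: sumr_ge0 => d _; apply: mangoldt_ge0.
Qed.

Lemma moebius_le1 (R : realType) (n : nat) : `|moebius R n| <= 1.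
Proof. by rewrite /moebius; case: ifP; rewrite ?normr0// normrX normrN1 expr1n. Qed.

Lemma moebius_primeM (R : realType) (p d : nat) : prime p -> (0 < d)%N ->
  moebius R (p * d) = if (p %| d)%N then 0 else - moebius R d.
Proof.
move=> pp d0; have p0 := prime_gt0 pp.
have pd0 : (0 < p * d)%N by rewrite muln_gt0 p0.
have pin : p \in primes (p * d) by rewrite mem_primes pp pd0 dvdn_mulr.
case: ifPn => pd.
  rewrite /moebius; case: ifP => // /allP/(_ _ pin).
  by rewrite lognM// (logn_prime p pp) eqxx add1n eqSS eqn0Ngt logn_gt0 mem_primes pp d0 pd.
have pnd : p \notin primes d by rewrite mem_primes pp d0.
have E : perm_eq (primes (p * d)) (p :: primes d).
  apply: uniq_perm; rewrite ?primes_uniq//= ?pnd ?primes_uniq// => q.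
  by rewrite primesM// primes_prime// !inE.
rewrite /moebius (perm_size E) (perm_all _ E)/= lognM// (logn_prime p pp) eqxx.
rewrite (_ : logn p d = 0%N); last by apply/eqP; rewrite eqn0Ngt logn_gt0.
rewrite addn0 eqxx/= (@eq_in_all _ _ (fun q => logn q d == 1%N)) => [|q qd].
  by case: ifP => _; rewrite ?oppr0// exprS mulN1r.
rewrite lognM// logn_prime//; case: (q =P p) => // qp.
by move: pnd; rewrite -qp; move: qd => /= ->.
Qed.

(** If [p] divides [n], the divisors [d] of [n / p] prime to [p] and their multiples
    [p * d] contribute opposite values, and the other divisors of [n] contribute 0. *)
Lemma sum_moebius_divisors (R : realType) (n : nat) : (0 < n)%N ->
  \sum_(d <- divisors n) moebius R d = (n == 1%N)%:R.
Proof.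
move=> n0; have [->|n1] := eqVneq n 1%N.
  by rewrite (_ : divisors 1 = [:: 1%N])// big_seq1 /moebius/= expr0.
have n2 : (1 < n)%N by case: n n1 n0 => [|[]].
have pp := pdiv_prime n2; set p := pdiv n in pp.
have /dvdnP[m nE] := pdiv_dvd n; rewrite -/p mulnC in nE.
have m0 : (0 < m)%N by move: n0; rewrite nE muln_gt0 => /andP[].
rewrite nE sum_divisors_primeM//.
suff -> : \sum_(d <- divisors m) moebius R (p * d) =
    - \sum_(d <- divisors m | ~~ (p %| d)%N) moebius R d by rewrite subrr.
rewrite -sumrN [RHS]big_mkcond big_seq [RHS]big_seq; apply: eq_bigr => d.
rewrite -dvdn_divisors// => dm; rewrite moebius_primeM ?(dvdn_gt0 m0 dm)//.
by rewrite if_neg.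
Qed.

Lemma sum_divisors_pairs (V : nmodType) (n : nat) (g : nat -> nat -> V) :
  (0 < n)%N ->
  \sum_(d <- divisors n) \sum_(e <- divisors (n %/ d)) g d e =
  \sum_(d <- divisors n) \sum_(e <- divisors n | (d * e %| n)%N) g d e.
Proof.
move=> n0; rewrite big_seq [RHS]big_seq; apply: eq_bigr => d.
rewrite -dvdn_divisors// => dn; have d0 := dvdn_gt0 n0 dn.
have nd0 : (0 < n %/ d)%N by rewrite divn_gt0// dvdn_leq.
rewrite -[RHS]big_filter; apply: perm_big.
apply: uniq_perm; rewrite ?filter_uniq ?divisors_uniq// => e.
rewrite mem_filter -!dvdn_divisors// mulnC dvdn_divRL//.
apply/idP/andP => [den|[]//]; split => //.
by apply: dvdn_trans den; rewrite dvdn_mulr.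
Qed.

Lemma moebius_inversion (R : realType) (n : nat) (f : nat -> R) : (0 < n)%N ->
  \sum_(d <- divisors n) moebius R d * (\sum_(e <- divisors (n %/ d)) f e) = f n.
Proof.
move=> n0; under eq_bigr do rewrite mulr_sumr.
rewrite sum_divisors_pairs//.
rewrite (exchange_big_dep predT)//=.
under eq_bigr do under eq_bigl do rewrite mulnC.
rewrite -(sum_divisors_pairs (fun e d => moebius R d * f e))//.
rewrite big_seq (eq_bigr (fun e => (e == n)%:R * f e)) => [|e].
  rewrite -big_seq (big_rem n) ?divisors_id//= eqxx mul1r big_seq big1 ?addr0// => e.
  by rewrite mem_rem_uniq ?divisors_uniq// inE => /andP[/negPf-> _]; rewrite mul0r.
rewrite -dvdn_divisors// => en; have e0 := dvdn_gt0 n0 en.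
have ne0 : (0 < n %/ e)%N by rewrite divn_gt0// dvdn_leq.
rewrite -mulr_suml sum_moebius_divisors//; congr (_%:R * _).
by rewrite -(eqn_pmul2l e0) muln1 (mulnC e) divnK// eq_sym.
Qed.

(** Moebius inversion of [sum_mangoldt_divisors]: as [ln d = ln n - ln (n / d)] and
    the Moebius function has sum 0 over the divisors of [n > 1], only
    [- ln (n / d)] matters. *)
Lemma sum_moebius_ln (R : realType) (n : nat) : (0 < n)%N ->
  \sum_(d <- divisors n) moebius R d * ln d%:R = - mangoldt R n.
Proof.
move=> n0.
have <- := @moebius_inversion _ n (mangoldt R) n0.
have : \sum_(d <- divisors n) moebius R d * ln n%:R = 0.
  rewrite -mulr_suml sum_moebius_divisors//.
  by case: eqP => [->|]; rewrite ?ln1 ?mulr0 ?mul0r.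
move=> H0; rewrite -[LHS]subr0 -[X in _ - X]H0 -sumrB -sumrN.
rewrite big_seq [RHS]big_seq; apply: eq_bigr => d.
rewrite -dvdn_divisors// => dn; have d0 := dvdn_gt0 n0 dn.
have nd0 : (0 < n %/ d)%N by rewrite divn_gt0// dvdn_leq.
rewrite sum_mangoldt_divisors// -[in ln n%:R](divnK dn) ln_natM//.
by ring.
Qed.

(** * Sums of logarithms *)

Lemma ln_natS_ge (R : realType) (n : nat) : (0 < n)%N ->
  n.+1%:R^-1 <= ln n.+1%:R - ln n%:R :> R.
Proof.
move=> n0; have p0 : 0 < n%:R :> R by rewrite ltr0n.
have q0 : 0 < n.+1%:R :> R by rewrite ltr0n.
have := @le_ln1Dx R (- n.+1%:R^-1).
have -> : 1 - n.+1%:R^-1 = n%:R / n.+1%:R :> R.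
  by rewrite -[in RHS]natr1; rewrite -natr1 in q0; field; rewrite gt_eqF.
rewrite ln_div ?posrE// ltrN2 invf_lt1// ltr1n => /(_ n0).
by rewrite -[X in _ -> _ <= X]opprB lerNr.
Qed.

Lemma ln_natS_le (R : realType) (n : nat) : (0 < n)%N ->
  ln n.+1%:R - ln n%:R <= n%:R^-1 :> R.
Proof.
move=> n0; have p0 : 0 < n%:R :> R by rewrite ltr0n.
have q0 : 0 < n.+1%:R :> R by rewrite ltr0n.
have := @le_ln1Dx R n%:R^-1.
have -> : 1 + n%:R^-1 = n.+1%:R / n%:R :> R.
  by rewrite -natr1; field; rewrite gt_eqF.
rewrite ln_div ?posrE//; apply.
by rewrite (lt_trans (ltrN10 _)) ?invr_gt0.
Qed.

Lemma ln_natS_le1 (R : realType) (n : nat) : (0 < n)%N ->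
  ln n.+1%:R - ln n%:R <= 1 :> R.
Proof.
by move=> n0; rewrite (le_trans (ln_natS_le R n0))// invf_le1 ?ltr0n// ler1n.
Qed.

Definition harmonic_sum (R : realType) (N : nat) : R :=
  \sum_(1 <= n < N.+1) n%:R^-1.

Lemma harmonic_sumS (R : realType) (N : nat) :
  harmonic_sum R N.+1 = harmonic_sum R N + N.+1%:R^-1.
Proof. by rewrite /harmonic_sum big_nat_recr. Qed.

(** The number [g] is the Euler-Mascheroni constant: [H_n - ln n] decreases and
    [H_n - ln n - 1 / n] increases. *)
Lemma harmonic_gamma (R : realType) : exists g : R, forall N, (0 < N)%N ->
  g <= harmonic_sum R N - ln N%:R <= g + N%:R^-1.
Proof.
pose u n : R := harmonic_sum R n.+1 - ln n.+1%:R.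
pose l n : R := u n - n.+1%:R^-1.
have lS : {homo l : m n / (m <= n)%N >-> m <= n}.
  apply: homo_leq => // [x y z|n]; first exact: le_trans.
  rewrite /l /u (harmonic_sumS R n.+1); have := @ln_natS_le R n.+1 isT.
  by set i := n.+1%:R^-1; set j := n.+2%:R^-1; lra.
have uS : {homo u : m n / (m <= n)%N >-> n <= m}.
  apply: homo_leq => // [x y z xy yz|n]; first exact: le_trans yz xy.
  rewrite /u (harmonic_sumS R n.+1); have := @ln_natS_ge R n.+1 isT.
  by set j := n.+2%:R^-1; lra.
have lu m n : l m <= u n.
  apply: le_trans (lS _ _ (leq_maxl m n)) _.
  apply: le_trans (uS _ _ (leq_maxr m n)).
  by rewrite /l lerBlDr lerDl invr_ge0 ler0n.
exists (sup (range l)) => -[//|n] _; apply/andP; split.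
  by apply: ge_sup => [|_ [m _ <-]]; [exists (l 0%N); exists 0%N|exact: lu].
have : l n <= sup (range l).
  apply: ub_le_sup; last by exists n.
  by exists (u 0%N) => _ [m _ <-]; exact: lu.
by rewrite /l /u; set i := n.+1%:R^-1; lra.
Qed.

Lemma sum_inv_ge (R : realType) (a b : nat) : (0 < a <= b)%N ->
  ln b%:R - ln a%:R <= \sum_(a <= n < b) n%:R^-1 :> R.
Proof.
move=> /andP[a0 ab]; rewrite -(@telescope_sumr _ _ _ (fun n => ln n%:R))//.
apply: ler_sum_nat => n /andP[an _].
by apply: ln_natS_le; apply: leq_trans an.
Qed.

Lemma sum_inv_le (R : realType) (a b : nat) : (0 < a <= b)%N ->
  \sum_(a <= n < b) n.+1%:R^-1 <= ln b%:R - ln a%:R :> R.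
Proof.
move=> /andP[a0 ab]; rewrite -(@telescope_sumr _ _ _ (fun n => ln n%:R))//.
apply: ler_sum_nat => n /andP[an _].
by apply: ln_natS_ge; apply: leq_trans an.
Qed.

Lemma harmonic_sum_le (R : realType) (N : nat) : (0 < N)%N ->
  harmonic_sum R N <= 1 + ln N%:R.
Proof.
move=> N0; rewrite /harmonic_sum big_nat_recl// invr1 lerD2l.
by have := @sum_inv_le R 1 N; rewrite N0 ln1 subr0 => /(_ isT).
Qed.

Definition sum_ln (R : realType) (N : nat) : R := \sum_(1 <= n < N.+1) ln n%:R.

Lemma sum_lnS (R : realType) (N : nat) :
  sum_ln R N.+1 = sum_ln R N + ln N.+1%:R.
Proof. by rewrite /sum_ln big_nat_recr. Qed.

(** Stirling's formula up to [O(ln N)]: the increment of [N ln N - N] from [N] to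
    [N + 1] is between [ln (N + 1) - 1 / (N + 1)] and [ln (N + 1)]. *)
Lemma sum_ln_bounds (R : realType) (N : nat) : (0 < N)%N ->
  N%:R * ln N%:R - N%:R <= sum_ln R N <= N%:R * ln N%:R - N%:R + (1 + ln N%:R).
Proof.
move=> N0.
suff : N%:R * ln N%:R - N%:R + 1 <= sum_ln R N <=
    N%:R * ln N%:R - N%:R + harmonic_sum R N.
  by have := harmonic_sum_le R N0; lra.
elim: N N0 => // -[_ _|n /(_ isT) IH _].
  by rewrite /sum_ln /harmonic_sum !big_nat1 ln1; lra.
rewrite sum_lnS (harmonic_sumS R n.+1).
have h1 := @ln_natS_le R n.+1 isT; have h2 := @ln_natS_ge R n.+1 isT.
have p0 : 0 < n.+1%:R :> R by rewrite ltr0n.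
have q0 : 0 < n.+2%:R :> R by rewrite ltr0n.
have e1 : n.+1%:R * (ln n.+2%:R - ln n.+1%:R) <= 1 :> R.
  by rewrite -(ler_pM2l p0) divff ?gt_eqF// in h1.
have e2 : 1 - n.+2%:R^-1 <= n.+1%:R * (ln n.+2%:R - ln n.+1%:R) :> R.
  rewrite -(ler_pM2l p0) in h2; apply: le_trans h2.
  rewrite -[X in _ <= X * _](addrK 1) natr1 mulrBl mul1r divff ?gt_eqF//.
move: IH e1 e2 h1 h2.
set i := n.+2%:R^-1; set j := n.+1%:R^-1; nra.
Qed.

Lemma sum_lnB (R : realType) (N : nat) :
  \sum_(1 <= n < N.+1) (ln N%:R - ln n%:R) = N%:R * ln N%:R - sum_ln R N.
Proof. by rewrite sumrB sumr_const_nat subn1/= mulr_natl. Qed.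

(** Raising [N] by 1 adds [ln (N + 1) - ln N <= 1 / N] to each logarithm, so the sum of
    squares grows by at most a constant, because the sum of the
    [1 + ln (N / n)] is at most [2 N] by Stirling's formula. *)
Lemma sum_sqr_ln_le (R : realType) (N : nat) :
  \sum_(1 <= n < N.+1) (1 + (ln N%:R - ln n%:R)) ^+ 2 <= 6 * N%:R :> R.
Proof.
elim: N => [|[|N] IH]; first by rewrite big_nil mulr0.
  by rewrite big_nat1 subrr; lra.
rewrite big_nat_recr//= subrr addr0 expr1n.
set d : R := ln N.+2%:R - ln N.+1%:R.
rewrite (eq_bigr (fun n => (1 + (ln N.+1%:R - ln n%:R)) ^+ 2 +
   (2 * d * (1 + (ln N.+1%:R - ln n%:R)) + d ^+ 2))); last first.
  by move=> n _; rewrite /d; ring.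
rewrite big_split big_split/= -mulr_sumr big_split/= !sumr_const_nat sum_lnB.
rewrite subn1/= -(mulr_natl 1) mulr1 -(mulr_natl (d ^+ 2)).
have p0 : 0 < N.+1%:R :> R by rewrite ltr0n.
have d0 : 0 <= d.
  by have := @ln_natS_ge R N.+1 isT; rewrite -/d; apply: le_trans; rewrite invr_ge0.
have d1 : d <= 1 by apply: ln_natS_le1.
have dN : N.+1%:R * d <= 1.
  by have := @ln_natS_le R N.+1 isT; rewrite -/d -(ler_pM2l p0) divff ?gt_eqF.
have dd : N.+1%:R * d ^+ 2 <= 1 by nra.
have /andP[st _] := @sum_ln_bounds R N.+1 isT.
have s2 : 2 * d * (N.+1%:R + (N.+1%:R * ln N.+1%:R - sum_ln R N.+1)) <= 4 by nra.
rewrite -[in N.+2%:R]natr1; lra.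
Qed.

(** Compare [ln n / n] with the increment of [(ln n)^2 / 2]; the difference is at most
    half the increment of [ln n], so an error [ln N / 2] suffices. *)
Lemma sum_ln_div_le (R : realType) (N : nat) : (0 < N)%N ->
  \sum_(1 <= n < N.+1) ln n%:R / n%:R <= (ln N%:R ^+ 2 + ln N%:R) / 2 :> R.
Proof.
elim: N => // -[_ _|N /(_ isT) IH _]; first by rewrite big_nat1 ln1 mul0r; lra.
rewrite big_nat_recr//=.
have := @ln_natS_ge R N.+1 isT; have := @ln_natS_le1 R N.+1 isT.
have : 0 < N.+2%:R^-1 :> R by rewrite invr_gt0 ltr0n.
have := ln_nat_ge0 R N.+1; have := ln_nat_ge0 R N.+2.
move: IH; set S := \sum_(_ <= _ < _) _.
set i := N.+2%:R^-1; set a := ln N.+2%:R; set b := ln N.+1%:R.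
move=> IH a0 b0 i0 h1 h2.
have : (a - b) * (a - (a - b)) >= i * (a - (a - b)) by nra.
nra.
Qed.

(** * Chebyshev's function and Selberg's formula *)

(** Both sides run over the pairs with [d * m <= N]. *)
Lemma sum_hyperbola_sym (V : nmodType) (N : nat) (f : nat -> nat -> V) :
  \sum_(1 <= d < N.+1) \sum_(1 <= m < (N %/ d).+1) f d m =
  \sum_(1 <= m < N.+1) \sum_(1 <= d < (N %/ m).+1) f d m.
Proof.
have widen (g : nat -> V) d : (0 < d)%N ->
    \sum_(1 <= m < (N %/ d).+1) g m = \sum_(1 <= m < N.+1 | (m * d <= N)%N) g m.
  move=> d0; rewrite (@big_nat_widen _ _ _ _ _ N.+1) ?ltnS ?leq_div//.
  by apply: eq_bigl => m; rewrite ltnS leq_divRL.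
under eq_big_nat => d /andP[d0 _] do rewrite widen//.
rewrite (exchange_big_dep_nat predT)//=.
apply: eq_big_nat => m /andP[m0 _]; rewrite widen//.
by apply: eq_bigl => d; rewrite mulnC.
Qed.

Lemma divn_le_div (R : realType) (N n : nat) : (0 < n)%N ->
  (N %/ n)%:R <= N%:R / n%:R :> R.
Proof.
by move=> n0; rewrite ler_pdivlMr ?ltr0n// -natrM ler_nat leq_divM.
Qed.

Lemma div_lt_divnS (R : realType) (N n : nat) : (0 < n)%N ->
  N%:R / n%:R < (N %/ n)%:R + 1 :> R.
Proof.
by move=> n0; rewrite natr1 ltr_pdivrMr ?ltr0n// -natrM ltr_nat ltn_ceil.
Qed.

Definition psi (R : realType) (N : nat) : R := \sum_(1 <= n < N.+1) mangoldt R n.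

Lemma psi0 (R : realType) : psi R 0 = 0.
Proof. by rewrite /psi big_nil. Qed.

Lemma psiS (R : realType) (N : nat) : psi R N.+1 = psi R N + mangoldt R N.+1.
Proof. by rewrite /psi big_nat_recr. Qed.

Lemma psi_homo (R : realType) : {homo psi R : m n / (m <= n)%N >-> m <= n}.
Proof.
apply: homo_leq => // [x y z|n]; first exact: le_trans.
by rewrite psiS lerDl mangoldt_ge0.
Qed.

Lemma psi_ge0 (R : realType) (N : nat) : 0 <= psi R N.
Proof. by rewrite -(psi0 R) psi_homo. Qed.

Lemma sum_mangoldt_divn (R : realType) (N : nat) :
  \sum_(1 <= n < N.+1) mangoldt R n * (N %/ n)%:R = sum_ln R N.
Proof.
transitivity (\sum_(1 <= n < N.+1) \sum_(1 <= m < (N %/ n).+1) mangoldt R n).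
  by apply: eq_bigr => n _; rewrite sumr_const_nat subn1/= mulr_natr.
rewrite -(sum_divisors_exchange _ (fun d _ => mangoldt R d)).
by apply: eq_big_nat => k /andP[k0 _]; rewrite sum_mangoldt_divisors.
Qed.

Lemma sum_psi_divn (R : realType) (N : nat) :
  \sum_(1 <= n < N.+1) psi R (N %/ n) = sum_ln R N.
Proof.
rewrite (sum_hyperbola_sym _ (fun _ m => mangoldt R m)) -sum_mangoldt_divn.
by apply: eq_bigr => n _; rewrite sumr_const_nat subn1/= mulr_natr.
Qed.

(** In the formula of [sum_mangoldt_divn] for [sum_ln N - 2 sum_ln (N/2)],
    [mangoldt d] has weight [N/d] - 2 [(N/2)/d], which is nonnegative, and at
    least 1 when [N/2 < d]. *)
Lemma psi_half (R : realType) (N : nat) :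
  psi R N - psi R (N %/ 2) <= sum_ln R N - 2 * sum_ln R (N %/ 2).
Proof.
set M := (N %/ 2)%N; have MN : (M <= N)%N by apply: leq_div.
have -> : sum_ln R M = \sum_(1 <= n < N.+1) mangoldt R n * (M %/ n)%:R.
  rewrite -sum_mangoldt_divn [RHS](@big_cat_nat _ _ _ M.+1)//=.
  rewrite [X in _ + X]big_nat [X in _ + X]big1 ?addr0// => n /andP[Mn _].
  by rewrite divn_small// mulr0.
rewrite -sum_mangoldt_divn mulr_sumr -sumrB.
rewrite /psi (@big_cat_nat _ _ _ M.+1 1%N N.+1)//= addrAC subrr add0r.
rewrite [X in _ <= X](@big_cat_nat _ _ _ M.+1)//= -[X in X <= _]add0r.
have key n : (0 < n)%N -> (2 * (M %/ n) <= N %/ n)%N.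
  by move=> n0; rewrite leq_divRL// -mulnA;
    have := leq_divM M n; have := leq_divM N 2; rewrite -/M; lia.
apply: lerD.
  rewrite big_nat sumr_ge0// => n /andP[n0 _].
  rewrite mulrCA -mulrBr mulr_ge0 ?mangoldt_ge0// subr_ge0 -natrM ler_nat.
  exact: key.
apply: ler_sum_nat => n /andP[Mn nN].
rewrite (divn_small Mn) mulr0 mulr0 subr0 ler_peMr ?mangoldt_ge0// ler1n.
by rewrite divn_gt0 ?(leq_ltn_trans _ Mn).
Qed.

(** Halving [N] repeatedly in [psi_half]: Stirling's formula bounds the right-hand side
    there by [5 N]. *)
Lemma psi_le (R : realType) (N : nat) : psi R N <= 10 * N%:R.
Proof.
elim/ltn_ind: N => N IH.
have [->|N0] := posnP N; first by rewrite psi0 mulr0.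
have [->|N1] := eqVneq N 1%N.
  by rewrite /psi big_nat1 /mangoldt/=; lra.
set M := (N %/ 2)%N.
have M0 : (0 < M)%N by rewrite divn_gt0//; lia.
have MN : (M < N)%N by rewrite /M; lia.
have NM2 : (2 * M <= N)%N by rewrite /M; lia.
have NM3 : (N <= 3 * M)%N by rewrite /M; lia.
have NM : (N <= 2 * M + 1)%N by rewrite /M; lia.
have h := psi_half R N; rewrite -/M in h.
have hM := IH M MN.
have /andP[_ t1] := sum_ln_bounds R N0.
have /andP[t2 _] := sum_ln_bounds R M0.
have a0 := ln_nat_ge0 R N; have b0 := ln_nat_ge0 R M.
have ab : ln N%:R <= ln M%:R + 2 :> R.
  have : ln 3 <= 2 :> R by have := @le_ln1Dx R 2; rewrite (_ : 1 + 2 = 3)//; apply; lra.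
  have := ler_ln_nat R N0 NM3; rewrite ln_natM//; lra.
have ba : ln M%:R <= ln N%:R :> R by apply: ler_ln_nat => //; apply: ltnW.
have aN : ln N%:R < N%:R :> R by apply: ln_sublinear; rewrite ltr0n.
rewrite -(ler_nat R) natrM in NM2; rewrite -(ler_nat R) natrD natrM in NM.
have N1' : 1 <= N%:R :> R by rewrite ler1n.
have q1 : N%:R * ln N%:R <= N%:R * (ln M%:R + 2) :> R by rewrite ler_wpM2l.
have q2 : (N%:R - 2 * M%:R) * ln M%:R <= 1 * ln M%:R :> R by rewrite ler_wpM2r//; lra.
lra.
Qed.

(** Replacing the integer part [N %/ n] by [N / n] in [sum_mangoldt_divn] costs at most
    [psi N]. *)
Lemma mertens (R : realType) (N : nat) : (0 < N)%N ->
  -1 <= \sum_(1 <= n < N.+1) mangoldt R n / n%:R - ln N%:R <= 11.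
Proof.
move=> N0; have p0 : 0 < N%:R :> R by rewrite ltr0n.
set S := \sum_(_ <= _ < _) _.
have l : sum_ln R N <= N%:R * S.
  rewrite -sum_mangoldt_divn mulr_sumr; apply: ler_sum_nat => n /andP[n0 _].
  by rewrite mulrCA ler_wpM2l ?mangoldt_ge0// divn_le_div.
have u : N%:R * S <= sum_ln R N + psi R N.
  rewrite -sum_mangoldt_divn mulr_sumr -big_split/=.
  apply: ler_sum_nat => n /andP[n0 _].
  rewrite mulrCA -[X in _ + X]mulr1 -mulrDr ler_wpM2l ?mangoldt_ge0//.
  exact/ltW/div_lt_divnS.
have /andP[s1 s2] := sum_ln_bounds R N0.
have P := psi_le R N.
have aN : ln N%:R < N%:R :> R by apply: ln_sublinear; rewrite ltr0n.
have N1' : 1 <= N%:R :> R by rewrite ler1n.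
by apply/andP; split; rewrite -(ler_pM2l p0) mulrBr; lra.
Qed.

Definition psi_rem (R : realType) (N : nat) : R := psi R N - N%:R.

Lemma psi_rem_le (R : realType) (N : nat) : `|psi_rem R N| <= 10 * N%:R.
Proof.
have := psi_le R N; have := psi_ge0 R N; have : 0 <= N%:R :> R by rewrite ler0n.
by rewrite /psi_rem ler_norml; lra.
Qed.

(** The identity of Tatuzawa and Iseki. Collecting the terms with [n * m = k] gives
    [F k] the coefficient [sum_(d | k) moebius d * (ln N - ln d)], which is
    [ln N] at [k = 1] plus [mangoldt k]. *)
Lemma tatuzawa_iseki (R : realType) (N : nat) (F : nat -> R) : (0 < N)%N ->
  \sum_(1 <= n < N.+1) moebius R n * (ln N%:R - ln n%:R) *
     (\sum_(1 <= m < (N %/ n).+1) F (n * m)%N) =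
  F 1%N * ln N%:R + \sum_(1 <= k < N.+1) mangoldt R k * F k.
Proof.
move=> N0; under eq_bigr do rewrite mulr_sumr.
rewrite -(sum_divisors_exchange _
  (fun n m => moebius R n * (ln N%:R - ln n%:R) * F (n * m)%N)).
transitivity (\sum_(1 <= k < N.+1)
    ((k == 1%N)%:R * (F k * ln N%:R) + mangoldt R k * F k)).
  apply: eq_big_nat => k /andP[k0 _].
  transitivity (\sum_(d <- divisors k) (moebius R d * (F k * ln N%:R) -
      moebius R d * ln d%:R * F k)).
    rewrite big_seq [RHS]big_seq; apply: eq_bigr => d.
    by rewrite -dvdn_divisors// => dk; rewrite mulnC divnK//; ring.
  rewrite sumrB -!mulr_suml sum_moebius_divisors// sum_moebius_ln//.
  by rewrite mulNr opprK.
rewrite big_split/=; congr (_ + _).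
rewrite big_ltn// eqxx mul1r big_nat big1 ?addr0// => k /andP[k1 _].
by case: eqP k1 => [->//|]; rewrite mul0r.
Qed.

(** Selberg's formula. In [tatuzawa_iseki] take [F k = psi (N / k) - N / k + g + 1],
    [g] being Euler's constant. The constant is such that the main terms of
    [sum_m F (n m)] cancel: with [M = N / n] they are [M ln M - M], [- M (ln M + g)]
    and [(g + 1) M]. What remains is [O(1 + ln (N / n))], and by [sum_sqr_ln_le]
    the left-hand side of the identity is [O(N)]. *)
Lemma selberg_rem (R : realType) : exists2 C : R, 0 <= C & forall N, (0 < N)%N ->
  `|psi_rem R N * ln N%:R +
    \sum_(1 <= k < N.+1) mangoldt R k * psi_rem R (N %/ k)| <= C * N%:R.
Proof.
have [g Hg] := harmonic_gamma R.
exists (6 * (3 + `|g|) + 10 + 11 * `|g + 1|).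
  by have := normr_ge0 g; have := normr_ge0 (g + 1); lra.
move=> N N0; set L := ln N%:R.
have L0 : 0 <= L by apply: ln_nat_ge0.
pose F k := psi R (N %/ k) - N%:R / k%:R + (g + 1).
have := tatuzawa_iseki F N0.
set A := \sum_(_ <= _ < _) _ => TI.
have bG n : (0 < n <= N)%N ->
    `|\sum_(1 <= m < (N %/ n).+1) F (n * m)%N| <= (3 + `|g|) * (1 + (L - ln n%:R)).
  move=> /andP[n0 nN]; set M := (N %/ n)%N.
  have M0 : (0 < M)%N by rewrite divn_gt0.
  set y : R := N%:R / n%:R.
  have -> : \sum_(1 <= m < M.+1) F (n * m)%N =
      sum_ln R M - y * harmonic_sum R M + (g + 1) * M%:R.
    rewrite -sum_psi_divn mulr_sumr -sumrB.
    rewrite (_ : (g + 1) * M%:R = \sum_(1 <= m < M.+1) (g + 1)); last first.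
      by rewrite sumr_const_nat subn1/= mulr_natr.
    rewrite -big_split; apply: eq_bigr => m _ /=.
    by rewrite /F /M /y divnMA natrM invfM mulrA.
  have y1 : M%:R <= y by apply: divn_le_div.
  have y2 : y < M%:R + 1 by apply: div_lt_divnS.
  have := sum_ln_bounds R M0; have := Hg M M0.
  have lL : ln M%:R <= L - ln n%:R.
    by rewrite lerBrDr -ln_natM// ler_ln_nat ?muln_gt0 ?M0// leq_divM.
  have l0 := ln_nat_ge0 R M.
  have M1 : 1 <= M%:R :> R by rewrite ler1n.
  have yM : y * M%:R^-1 <= 2 by rewrite ler_pdivrMr ?ltr0n//; lra.
  have M0' : 0 <= M%:R^-1 :> R by rewrite invr_ge0 ler0n.
  move: lL l0 M1 yM M0' y1 y2; set l := ln M%:R; set i := M%:R^-1.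
  set H := harmonic_sum R M; set T := sum_ln R M.
  move=> lL l0 M1 yM M0' y1 y2 /andP[h1 h2] /andP[t1 t2].
  (* The three error terms: harmonic sum, and [y - M < 1] against [l] and [g]. *)
  have th : 0 <= y * (H - l - g) <= 2.
    apply/andP; split; first by apply: mulr_ge0; lra.
    by apply: le_trans yM; apply: ler_wpM2l; lra.
  have e1 : 0 <= (y - M%:R) * l <= l.
    apply/andP; split; first by apply: mulr_ge0; lra.
    by rewrite ler_piMl//; lra.
  have e2 : `|(y - M%:R) * g| <= `|g|.
    rewrite normrM ler_piMl// ger0_norm; lra.
  have gl : 0 <= `|g| * (L - ln n%:R) by apply: mulr_ge0 => //; lra.
  move: th e1 e2; rewrite !ler_norml => /andP[th1 th2] /andP[e11 e12] /andP[e21 e22].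
  have := normr_ge0 g; lra.
have bA : `|A| <= 6 * (3 + `|g|) * N%:R.
  apply: le_trans (ler_norm_sum _ _ _) _.
  apply: (@le_trans _ _ (\sum_(1 <= n < N.+1) (3 + `|g|) * (1 + (L - ln n%:R)) ^+ 2)).
    apply: ler_sum_nat => n nN; have := bG n nN; case/andP: nN => n0 nN.
    rewrite !normrM; have := moebius_le1 R n.
    have : 0 <= L - ln n%:R by rewrite subr_ge0 ler_ln_nat.
    set B := `|\sum_(_ <= _ < _) _|; set m := `|moebius R n|; set x := L - ln n%:R.
    move=> x0 m1 hB; rewrite (ger0_norm x0).
    have B0 : 0 <= B by apply: normr_ge0.
    have gp : 0 <= 3 + `|g| by have := normr_ge0 g; lra.
    have : m * x * B <= 1 * x * B by rewrite -!mulrA ler_wpM2r// mulr_ge0.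
    have : x * B <= (1 + x) * B by rewrite ler_wpM2r//; lra.
    have : (1 + x) * B <= (1 + x) * ((3 + `|g|) * (1 + x)) by rewrite ler_wpM2l//; lra.
    by lra.
  rewrite -mulr_sumr -mulrA mulrCA; apply: ler_wpM2l.
    by have := normr_ge0 g; lra.
  exact: sum_sqr_ln_le.
have E1 : F 1%N = psi_rem R N + (g + 1) by rewrite /F divn1 invr1 mulr1.
have E2 : \sum_(1 <= k < N.+1) mangoldt R k * F k =
  \sum_(1 <= k < N.+1) mangoldt R k * psi_rem R (N %/ k) -
  \sum_(1 <= k < N.+1) mangoldt R k * (N%:R / k%:R - (N %/ k)%:R) +
  psi R N * (g + 1).
  rewrite /psi mulr_suml -sumrB -big_split; apply: eq_bigr => k _/=.
  by rewrite /F /psi_rem; ring.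
have b3 : 0 <= \sum_(1 <= k < N.+1) mangoldt R k * (N%:R / k%:R - (N %/ k)%:R) <= 10 * N%:R.
  apply/andP; split.
    rewrite big_nat; apply: sumr_ge0 => k /andP[k0 _].
    by rewrite mulr_ge0 ?mangoldt_ge0// subr_ge0 divn_le_div.
  apply: le_trans (psi_le R N); apply: ler_sum_nat => k /andP[k0 _].
  by rewrite ler_piMr ?mangoldt_ge0// lerBlDl ltW// div_lt_divnS.
have LN : L <= N%:R by apply/ltW/ln_sublinear; rewrite ltr0n.
have b4 : `|(g + 1) * L| <= `|g + 1| * N%:R.
  by rewrite normrM ler_wpM2l// ger0_norm.
have b5 : `|(g + 1) * psi R N| <= `|g + 1| * (10 * N%:R).
  by rewrite normrM ler_wpM2l// ger0_norm ?psi_ge0// psi_le.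
move: TI bA b3 b4 b5; rewrite E1 E2 -/L !ler_norml.
by lra.
Qed.

(** Selberg's formula for [psi] itself, where [sum_mangoldt_divn] gives the sum
    over the main terms. *)
Lemma selberg_psi (R : realType) : exists2 C : R, 0 <= C & forall N, (0 < N)%N ->
  `|psi R N * ln N%:R + \sum_(1 <= k < N.+1) mangoldt R k * psi R (N %/ k)
    - 2 * N%:R * ln N%:R| <= C * N%:R.
Proof.
have [C C0 H] := selberg_rem R.
exists (C + 1) => [|N N0]; first by rewrite addr_ge0.
have := H N N0; have := sum_ln_bounds R N0.
have LN : ln N%:R <= N%:R :> R by apply/ltW/ln_sublinear; rewrite ltr0n.
have N1' : 1 <= N%:R :> R by rewrite ler1n.
rewrite -sum_mangoldt_divn /psi_rem.
under [in X in _ -> X -> _]eq_bigr do rewrite mulrBr.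
rewrite sumrB !ler_norml; lra.
Qed.

(** * Iterating Selberg's formula *)

(** The coefficients that appear when [selberg_rem] is substituted into itself. *)
Definition selberg_weight (R : realType) (n : nat) : R :=
  mangoldt R n * ln n%:R +
  \sum_(d <- divisors n) mangoldt R d * mangoldt R (n %/ d).

Lemma sum_mangoldt_conv (R : realType) (N : nat) (h : nat -> R) :
  \sum_(1 <= n < N.+1)
    (\sum_(d <- divisors n) mangoldt R d * mangoldt R (n %/ d)) * h (N %/ n)%N =
  \sum_(1 <= k < N.+1) mangoldt R k *
    \sum_(1 <= j < (N %/ k).+1) mangoldt R j * h (N %/ k %/ j)%N.
Proof.
transitivity (\sum_(1 <= k < N.+1) \sum_(1 <= j < (N %/ k).+1)
    mangoldt R k * mangoldt R j * h (N %/ (k * j))%N); last first.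
  apply: eq_bigr => k _; rewrite mulr_sumr; apply: eq_bigr => j _.
  by rewrite divnMA mulrA.
rewrite -(sum_divisors_exchange _
  (fun k j => mangoldt R k * mangoldt R j * h (N %/ (k * j))%N)).
apply: eq_big_nat => n /andP[n0 _]; rewrite mulr_suml.
rewrite big_seq [RHS]big_seq; apply: eq_bigr => d.
by rewrite -dvdn_divisors// => dn; rewrite (mulnC d) divnK.
Qed.

Lemma sum_ln_le (R : realType) (N : nat) : (0 < N)%N ->
  sum_ln R N <= N%:R * (1 + ln N%:R).
Proof.
move=> N0; have /andP[_ ] := sum_ln_bounds R N0.
have : ln N%:R < N%:R :> R by apply: ln_sublinear; rewrite ltr0n.
have : 1 <= N%:R :> R by rewrite ler1n.
lra.
Qed.

(** Multiply [selberg_rem] at [N] by [ln N = ln k + ln (N / k) + O(1)] and replace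
    [psi_rem (N / k) * ln (N / k)] by means of [selberg_rem] at [N / k]. The two resulting
    sums have opposite signs, so the absolute values of their coefficients add
    up to [selberg_weight]. *)
Lemma selberg_iterate (R : realType) : exists2 C : R, 0 <= C & forall N, (0 < N)%N ->
  `|psi_rem R N| * ln N%:R ^+ 2 <=
  \sum_(1 <= n < N.+1) `|psi_rem R (N %/ n)| * selberg_weight R n +
  C * (N%:R * (1 + ln N%:R)).
Proof.
have [C C0 HC] := selberg_rem R.
exists (2 * C + 10) => [|N N0]; first by lra.
set L := ln N%:R; have L0 : 0 <= L by apply: ln_nat_ge0.
set r := psi_rem R.
set X := \sum_(1 <= k < N.+1) mangoldt R k * r (N %/ k)%N.
set Y := \sum_(1 <= k < N.+1) mangoldt R k * (r (N %/ k)%N * ln (N %/ k)%:R).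
set Z := \sum_(1 <= k < N.+1) mangoldt R k * ln k%:R * r (N %/ k)%N.
set D := \sum_(1 <= k < N.+1)
  mangoldt R k * r (N %/ k)%N * (L - ln k%:R - ln (N %/ k)%:R).
set V := \sum_(1 <= n < N.+1)
  (\sum_(d <- divisors n) mangoldt R d * mangoldt R (n %/ d)) * r (N %/ n)%N.
set G := \sum_(1 <= n < N.+1) `|r (N %/ n)%N| * selberg_weight R n.
have XE : X * L = Y + Z + D.
  rewrite /X mulr_suml -!big_split; apply: eq_bigr => k _ /=; ring.
have hX : `|(r N * L + X) * L| <= C * N%:R * L.
  by rewrite normrM (ger0_norm L0) ler_wpM2r//; apply: HC.
have hYV : `|Y + V| <= C * sum_ln R N.
  rewrite /V sum_mangoldt_conv /Y -big_split/= -sum_mangoldt_divn mulr_sumr.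
  apply: le_trans (ler_norm_sum _ _ _) _.
  apply: ler_sum_nat => k /andP[k0 kN].
  rewrite -mulrDr normrM (ger0_norm (mangoldt_ge0 _ _)) mulrCA.
  rewrite ler_wpM2l ?mangoldt_ge0//; apply: HC.
  by rewrite divn_gt0.
have hD : `|D| <= 10 * sum_ln R N.
  rewrite -sum_mangoldt_divn mulr_sumr.
  apply: le_trans (ler_norm_sum _ _ _) _.
  apply: ler_sum_nat => k /andP[k0 kN].
  have M0 : (0 < N %/ k)%N by rewrite divn_gt0.
  rewrite !normrM (ger0_norm (mangoldt_ge0 _ _)) -mulrA [leRHS]mulrCA.
  rewrite ler_wpM2l ?mangoldt_ge0// -[leRHS]mulr1 ler_pM ?psi_rem_le//.
  have l1 : ln k%:R + ln (N %/ k)%:R <= L.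
    by rewrite -ln_natM// ler_ln_nat ?muln_gt0 ?k0// mulnC leq_divM.
  have l2 : L <= ln k%:R + ln (N %/ k).+1%:R.
    by rewrite -ln_natM// ler_ln_nat// mulnC ltnW// ltn_ceil.
  have := ln_natS_le1 R M0; rewrite ler_norml; lra.
have hVZ : `|V - Z| <= G.
  rewrite /V /Z -sumrB; apply: le_trans (ler_norm_sum _ _ _) _.
  apply: ler_sum => k _; rewrite -mulrBl normrM mulrC ler_wpM2l//.
  rewrite /selberg_weight; set c := \sum_(_ <- _) _.
  have c0 : 0 <= c by apply: sumr_ge0 => d _; rewrite mulr_ge0 ?mangoldt_ge0.
  have : 0 <= mangoldt R k * ln k%:R by rewrite mulr_ge0 ?mangoldt_ge0 ?ln_nat_ge0.
  by rewrite ler_norml; lra.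
have hT := sum_ln_le R N0; rewrite -/L in hT.
have hCT : C * sum_ln R N <= C * (N%:R * (1 + L)) by rewrite ler_wpM2l.
have CN : 0 <= C * N%:R by rewrite mulr_ge0.
rewrite -(ger0_norm (sqr_ge0 L)) -normrM.
have -> : r N * L ^+ 2 = (r N * L + X) * L - (Y + V) + (V - Z) - D.
  rewrite [(r N * L + X) * L](_ : _ = r N * L ^+ 2 + X * L); last by ring.
  by rewrite XE; ring.
move: hX hYV hD hVZ; rewrite !ler_norml; lra.
Qed.

Lemma sum_mangoldt_lnB (R : realType) (N : nat) :
  0 <= \sum_(1 <= n < N.+1) mangoldt R n * (ln N%:R - ln n%:R) <= 10 * N%:R.
Proof.
apply/andP; split.
  rewrite big_nat sumr_ge0// => n /andP[n0 nN].
  by rewrite mulr_ge0 ?mangoldt_ge0// subr_ge0 ler_ln_nat.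
elim: N => [|[|N] IH]; first by rewrite big_nil mulr0.
  by rewrite big_nat1 subrr mulr0; lra.
rewrite big_nat_recr//= subrr mulr0 addr0.
set d : R := ln N.+2%:R - ln N.+1%:R.
rewrite (eq_bigr (fun n => mangoldt R n * (ln N.+1%:R - ln n%:R) +
   mangoldt R n * d)); last by move=> n _; rewrite /d; ring.
rewrite big_split/= -mulr_suml -/(psi R N.+1).
have p0 : 0 < N.+1%:R :> R by rewrite ltr0n.
have d0 : 0 <= d.
  by have := @ln_natS_ge R N.+1 isT; rewrite -/d; apply: le_trans; rewrite invr_ge0.
have dN : N.+1%:R * d <= 1.
  by have := @ln_natS_le R N.+1 isT; rewrite -/d -(ler_pM2l p0) divff ?gt_eqF.
have : psi R N.+1 * d <= 10 * N.+1%:R * d by rewrite ler_wpM2r ?psi_le.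
by rewrite -[in N.+2%:R]natr1; lra.
Qed.

(** The weight is [2 ln n] on average: up to the [O(N)] of [sum_mangoldt_lnB], its sum
    is the quantity that [selberg_psi] compares with [2 N ln N]. *)
Lemma sum_selberg_weight (R : realType) : exists2 C : R, 0 <= C & forall N,
  `|\sum_(1 <= n < N.+1) (selberg_weight R n - 2 * ln n%:R)| <= C * N%:R.
Proof.
have [C C0 HC] := selberg_psi R.
exists (C + 14) => [|N]; first by lra.
have [->|N0] := posnP N; first by rewrite big_nil normr0 mulr0.
rewrite sumrB -mulr_sumr -/(sum_ln R N) big_split/=.
have -> : \sum_(1 <= n < N.+1)
    (\sum_(d <- divisors n) mangoldt R d * mangoldt R (n %/ d)) =
    \sum_(1 <= k < N.+1) mangoldt R k * psi R (N %/ k).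
  have := sum_mangoldt_conv N (fun _ => 1 : R).
  under eq_bigr do rewrite mulr1; move=> ->.
  by apply: eq_bigr => k _; under eq_bigr do rewrite mulr1.
have := sum_mangoldt_lnB R N.
have -> : \sum_(1 <= n < N.+1) mangoldt R n * (ln N%:R - ln n%:R) =
    psi R N * ln N%:R - \sum_(1 <= n < N.+1) mangoldt R n * ln n%:R.
  by rewrite /psi mulr_suml -sumrB; apply: eq_bigr => n _; rewrite mulrBr.
have := HC N N0; have := sum_ln_bounds R N0.
have LN : ln N%:R <= N%:R :> R by apply/ltW/ln_sublinear; rewrite ltr0n.
have N1' : 1 <= N%:R :> R by rewrite ler1n.
rewrite !ler_norml; lra.
Qed.

Lemma abel_summation (R : comNzRingType) (N : nat) (w g : nat -> R) :
  \sum_(1 <= n < N.+1) w n * g n =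
  \sum_(1 <= n < N.+1) (\sum_(1 <= i < n.+1) w i) * (g n - g n.+1) +
  (\sum_(1 <= i < N.+1) w i) * g N.+1.
Proof.
elim: N => [|N IH]; first by rewrite !big_nil mul0r addr0.
rewrite big_nat_recr// [X in X + _ = _]IH.
rewrite [in RHS]big_nat_recr//= [in RHS](big_nat_recr N.+1)//=.
ring.
Qed.

(** Summation by parts replaces [selberg_weight] by its average [2 ln n]. This costs
    [sum_n n * |g n - g (n + 1)|] with [g n = |psi_rem (N / n)|]. The increments of [g]
    are bounded by those of the monotone [psi (N / n) + N / n], for which a second
    summation by parts leaves only [sum_n (psi (N / n) + N / n) = O(N ln N)]. *)
Lemma psi_rem_average (R : realType) : exists2 C : R, 0 <= C & forall N, (0 < N)%N ->
  `|psi_rem R N| * ln N%:R ^+ 2 <=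
  2 * \sum_(1 <= n < N.+1) `|psi_rem R (N %/ n)| * ln n%:R +
  C * (N%:R * (1 + ln N%:R)).
Proof.
have [C C0 HC] := selberg_iterate R.
have [B B0 HB] := sum_selberg_weight R.
exists (C + 2 * B) => [|N N0]; first by lra.
set g := fun n => `|psi_rem R (N %/ n)|.
pose h n : R := psi R (N %/ n) + (N %/ n)%:R.
have gN : g N.+1 = 0 by rewrite /g divn_small// /psi_rem psi0 subrr normr0.
have hN : h N.+1 = 0 by rewrite /h divn_small// psi0 add0r.
have gh n : (0 < n)%N -> `|g n - g n.+1| <= h n - h n.+1.
  move=> n0; apply: le_trans (ler_dist_dist _ _) _.
  have le : (N %/ n.+1 <= N %/ n)%N by apply: leq_div2l.
  have := psi_homo R le; move: le; rewrite -(ler_nat R) /h /psi_rem ler_norml.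
  lra.
have := HC N N0.
have -> : \sum_(1 <= n < N.+1) g n * selberg_weight R n =
   2 * (\sum_(1 <= n < N.+1) g n * ln n%:R) +
   \sum_(1 <= n < N.+1) (selberg_weight R n - 2 * ln n%:R) * g n.
  by rewrite mulr_sumr -big_split; apply: eq_bigr => n _ /=; ring.
suff : \sum_(1 <= n < N.+1) (selberg_weight R n - 2 * ln n%:R) * g n <=
   2 * B * (N%:R * (1 + ln N%:R)) by lra.
rewrite abel_summation gN mulr0 addr0.
have s : \sum_(1 <= n < N.+1) n%:R * (h n - h n.+1) <= 2 * (N%:R * (1 + ln N%:R)).
  have := abel_summation N (fun=> 1) h; rewrite hN mulr0 addr0.
  have -> : \sum_(1 <= n < N.+1) (\sum_(1 <= i < n.+1) 1) * (h n - h n.+1) =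
            \sum_(1 <= n < N.+1) n%:R * (h n - h n.+1).
    by apply: eq_bigr => n _; rewrite sumr_const_nat subn1.
  move=> <-; under eq_bigr do rewrite mul1r.
  rewrite /h big_split/= sum_psi_divn.
  have t := sum_ln_le R N0.
  have : \sum_(1 <= n < N.+1) (N %/ n)%:R <= N%:R * harmonic_sum R N.
    rewrite mulr_sumr; apply: ler_sum_nat => n /andP[n0 _].
    exact: divn_le_div.
  have : N%:R * harmonic_sum R N <= N%:R * (1 + ln N%:R).
    by rewrite ler_wpM2l// harmonic_sum_le.
  lra.
apply: (@le_trans _ _ (B * \sum_(1 <= n < N.+1) n%:R * (h n - h n.+1))).
  rewrite mulr_sumr; apply: ler_sum_nat => n /andP[n0 _].
  apply: le_trans (ler_norm _) _; rewrite normrM mulrA.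
  exact: ler_pM (normr_ge0 _) (normr_ge0 _) (HB n) (gh n n0).
by rewrite (mulrC 2) -mulrA ler_wpM2l.
Qed.

(** * From the averaged inequality to [psi N ~ N] *)

Lemma ln_nat_large (R : realType) (X : R) :
  exists N0, forall N, (N0 <= N)%N -> X <= ln N%:R.
Proof.
exists (Num.truncn (expR X)).+1 => N hN.
have h : expR X <= N%:R.
  by apply/ltW/(lt_le_trans (truncnS_gt _)); rewrite ler_nat.
by rewrite -(expRK X) ler_ln// posrE ?expR_gt0// (lt_le_trans (expR_gt0 X) h).
Qed.

Lemma ln_le_eps (R : realType) (e : R) : 0 < e ->
  exists2 X : R, 0 < X & forall x, X <= x -> ln x <= e * x.
Proof.
move=> e0; pose d := e / 2; have d0 : 0 < d by rewrite /d; lra.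
exists (Num.max 1 (- ln d / d)) => [|x]; first by rewrite lt_max ltr01.
rewrite ge_max => /andP[x1 h]; have x0 : 0 < x by lra.
rewrite ler_pdivrMr// in h.
have := @ln_sublinear R (d * x); rewrite mulr_gt0// lnM ?posrE// => /(_ isT).
have -> : e = d + d by rewrite /d; lra.
lra.
Qed.

Lemma ln_nat_le_eps (R : realType) (e : R) : 0 < e ->
  exists N0, forall N, (N0 <= N)%N -> ln N%:R <= e * N%:R.
Proof.
move=> /ln_le_eps[X _ HX]; exists (Num.truncn X).+1 => N hN.
by apply/HX/ltW/(lt_le_trans (truncnS_gt _)); rewrite ler_nat.
Qed.

(** The second sum in [selberg_psi] is nondecreasing, so [psi N * ln N] cannot increase
    faster than [2 N ln N + O(N)]: in a short interval [psi] gains at most twice its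
    expected increment, so that the remainder moves by at most the length, up to
    [O(N / ln N)]. *)
Lemma psi_rem_short (R : realType) : exists2 C : R, 0 <= C &
  forall M N, (0 < M <= N)%N ->
  `|psi_rem R N - psi_rem R M| * ln N%:R <= (N%:R - M%:R) * ln N%:R + C * N%:R.
Proof.
have [C C0 HC] := selberg_psi R.
exists (2 * C + 2) => [|M N /andP[M0 MN]]; first by lra.
have N0 : (0 < N)%N by apply: leq_trans MN.
pose Q N := \sum_(1 <= k < N.+1) mangoldt R k * psi R (N %/ k).
have QMN : Q M <= Q N.
  rewrite /Q [leRHS](@big_cat_nat _ _ _ M.+1 1%N N.+1)//= -[leLHS]addr0.
  apply: lerD.
    apply: ler_sum => k _; rewrite ler_wpM2l ?mangoldt_ge0//.
    by apply: psi_homo; apply: leq_div2r.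
  by apply: sumr_ge0 => k _; rewrite mulr_ge0 ?mangoldt_ge0 ?psi_ge0.
have := HC N N0; have := HC M M0; rewrite -/(Q N) -/(Q M).
have MN' : M%:R <= N%:R :> R by rewrite ler_nat.
have pMN := psi_homo R MN; have pM := psi_ge0 R M.
have m0 : 0 < M%:R :> R by rewrite ltr0n.
have LMN : ln M%:R <= ln N%:R :> R by apply: ler_ln_nat.
have LN0 := ln_nat_ge0 R N.
have e : M%:R * (ln N%:R - ln M%:R) <= N%:R - M%:R :> R.
  have := @le_ln1Dx R (N%:R / M%:R - 1).
  rewrite [1 + _]addrC subrK ln_div ?posrE ?ltr0n// => h.
  have {}h : ln N%:R - ln M%:R <= N%:R / M%:R - 1 :> R.
    by apply: h; rewrite ltrBrDl subrr divr_gt0 ?ltr0n.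
  rewrite -(ler_pM2l m0) in h; apply: le_trans h _.
  by rewrite mulrBr mulrCA divff ?gt_eqF// !mulr1.
have f : 0 <= psi R M * (ln N%:R - ln M%:R) by rewrite mulr_ge0// subr_ge0.
rewrite -[X in _ * X <= _](ger0_norm LN0) -normrM /psi_rem.
have CM : C * M%:R <= C * N%:R by rewrite ler_wpM2l.
have g : 0 <= (psi R N - psi R M) * ln N%:R by rewrite mulr_ge0// subr_ge0.
have CN : 0 <= C * N%:R by rewrite mulr_ge0// ler0n.
by rewrite !ler_norml; lra.
Qed.

(** Summation by parts turns Mertens' theorem for the sum of [mangoldt n / n], less the
    harmonic sum, into this bound on the mean of [psi_rem n / n ^ 2]. *)
Lemma sum_psi_rem_le (R : realType) (N : nat) :
  `|\sum_(1 <= n < N.+1) psi_rem R n * (n%:R^-1 - n.+1%:R^-1)| <= 21.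
Proof.
have [->|N0] := posnP N; first by rewrite big_nil normr0.
have := abel_summation N (mangoldt R) (fun n => n%:R^-1).
have := abel_summation N (fun=> 1 : R) (fun n => n%:R^-1).
have := @sum_inv_ge R 1 N.+1 isT; rewrite ln1 subr0 -/(harmonic_sum R N).
have := harmonic_sum_le R N0; have := mertens R N0.
set A := \sum_(_ <= _ < _) _; move=> hA h1 h2.
under eq_bigr do rewrite mul1r.
rewrite -/(harmonic_sum R N) => e1 e2.
have -> : \sum_(1 <= n < N.+1) psi_rem R n * (n%:R^-1 - n.+1%:R^-1) =
    A - harmonic_sum R N - psi_rem R N * N.+1%:R^-1.
  rewrite e1 e2 /psi_rem mulrBl sumr_const_nat subn1/= -/(psi R N).
  under eq_bigr do rewrite mulrBl.
  rewrite sumrB; rewrite -[X in _ - X = _](_ : \sum_(1 <= n < N.+1)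
     (\sum_(1 <= i < n.+1) 1) * (n%:R^-1 - n.+1%:R^-1) = _); last first.
    by apply: eq_bigr => n _; rewrite sumr_const_nat subn1.
  rewrite -[X in X - _ = _](_ : \sum_(1 <= n < N.+1)
     (\sum_(1 <= i < n.+1) mangoldt R i) * (n%:R^-1 - n.+1%:R^-1) = _)//.
  set i := N.+1%:R^-1; ring.
have : `|psi_rem R N * N.+1%:R^-1| <= 10.
  rewrite normrM (ger0_norm (_ : 0 <= N.+1%:R^-1)) ?invr_ge0 ?ler0n//.
  rewrite ler_pdivrMr ?ltr0n//; apply: le_trans (psi_rem_le R N) _.
  by rewrite ler_pM2l// ler_nat.
have : ln N%:R <= ln N.+1%:R :> R by apply: ler_ln_nat.
by move: hA; rewrite !ler_norml; set i := N.+1%:R^-1; lra.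
Qed.

Lemma sum_psi_rem_range (R : realType) (a b : nat) : (0 < a <= b)%N ->
  `|\sum_(a <= n < b) psi_rem R n * (n%:R^-1 - n.+1%:R^-1)| <= 42.
Proof.
case: a => // a; case: b => // b /andP[_ ab].
have := sum_psi_rem_le R b; have := sum_psi_rem_le R a.
rewrite [X in _ -> `|X| <= _ -> _](@big_cat_nat _ _ _ a.+1)//=.
set A := \sum_(_ <= _ < _) _; set B := \sum_(_ <= _ < _) _.
by rewrite !ler_norml; lra.
Qed.

(** Suppose that [|psi_rem n| > e * n] on all of [[a, K a[]. The jumps of the remainder
    are at most logarithmic, too small to cross from [- e n] to [e n], so it keeps its
    sign there. Then nothing cancels in the sum of [sum_psi_rem_range], which is
    at least about [e * ln K], contradicting the bound 42 if [K] is large. *)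
Lemma psi_rem_small_point (R : realType) (e : R) : 0 < e ->
  exists K a0, [/\ (0 < K)%N, (0 < a0)%N & forall a, (a0 <= a)%N ->
    exists2 z, (a <= z < K * a)%N & `|psi_rem R z| <= e * z%:R].
Proof.
move=> e0.
have [K HK] := ln_nat_large (ln 2 + 43 / e).
have [n0 Hn0] := ln_nat_le_eps e0.
pose a0 := maxn n0 (Num.truncn e^-1).+1.
exists (maxn K 2), a0; split=> [||a aa].
- by rewrite leq_max orbT.
- by rewrite leq_max orbT.
set k := maxn K 2.
have k1 : (1 < k)%N by rewrite leq_max orbT.
have k0 : (0 < k)%N by apply: ltnW.
have a0' : (0 < a)%N by apply: leq_trans aa; rewrite leq_max orbT.
apply: contrapT => H.
have big n : (a <= n < k * a)%N -> e * n%:R < `|psi_rem R n|.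
  by move=> hn; rewrite ltNge; apply/negP => h; apply: H; exists n.
have en n : (a <= n)%N -> 1 <= e * n%:R.
  move=> an; rewrite mulrC -ler_pdivrMr// mul1r.
  apply/ltW/(lt_le_trans (truncnS_gt _)); rewrite ler_nat.
  by apply: leq_trans an; apply: leq_trans aa; rewrite leq_max leqnn orbT.
have lnn n : (a <= n)%N -> ln n%:R <= e * n%:R.
  move=> an; apply: Hn0; apply: leq_trans an; apply: leq_trans aa.
  by rewrite leq_max leqnn.
have rS n : psi_rem R n.+1 = psi_rem R n + mangoldt R n.+1 - 1.
  by rewrite /psi_rem psiS -natr1; lra.
have sg s : `|s| = 1 -> 0 < s * psi_rem R a ->
    forall n, (a <= n < k * a)%N -> e * n%:R < s * psi_rem R n.
  move=> s1 sa; elim=> [|n IH] /andP[an nk].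
    by move: (leq_trans a0' an).
  have bn := big n.+1; rewrite an nk in bn; move: (bn isT) => {}bn.
  have : 0 < s * psi_rem R n.+1.
    move: an; rewrite leq_eqVlt => /orP[/eqP <-//|]; rewrite ltnS => an.
    have {}IH : e * n%:R < s * psi_rem R n by apply: IH; rewrite an (ltn_trans _ nk).
    have E1 := en n an; have E2 := lnn n.+1 (leqW an).
    have L0 := mangoldt_ge0 R n.+1; have L1 := mangoldt_le_ln R n.+1.
    move: bn; rewrite rS.
    have [s0|s0] := leP 0 s.
      by move: s1 IH; rewrite ger0_norm// => ->; lra.
    move: s1 IH; rewrite ltr0_norm// => s1.
    have -> : s = -1 by lra.
    move=> IH bn; rewrite ltNge; apply/negP => hs.
    by move: bn; rewrite ger0_norm; lra.
  rewrite -[X in 0 < X -> _]mul1r => h; apply: lt_le_trans bn _.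
  by rewrite -[leLHS]mul1r -s1 -normrM ler_norml; rewrite mul1r in h; lra.
have [s s1 sa] : exists2 s : R, `|s| = 1 & 0 < s * psi_rem R a.
  have := big a; rewrite leqnn ltn_Pmull// => /(_ isT).
  have [ra _|ra _|ra] := ltrgt0P (psi_rem R a).
  - by exists 1; rewrite ?normr1 ?mul1r.
  - by exists (-1); rewrite ?normrN1 ?mulN1r ?oppr_gt0.
  by have := en a (leqnn a); lra.
have ka : (a <= k * a)%N by rewrite leq_pmull.
have hr : `|\sum_(a <= n < k * a) psi_rem R n * (n%:R^-1 - n.+1%:R^-1)| <= 42.
  by apply: sum_psi_rem_range; rewrite a0'.
have lo : e * (ln k%:R - ln 2) <=
    s * \sum_(a <= n < k * a) psi_rem R n * (n%:R^-1 - n.+1%:R^-1).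
  apply: (@le_trans _ _ (e * \sum_(a <= n < k * a) n.+1%:R^-1)).
    apply: ler_wpM2l; first exact: ltW.
    have := @sum_inv_ge R a.+1 (k * a).+1; rewrite /= ltnS ka => /(_ isT).
    rewrite big_add1/=; apply: le_trans.
    have : ln (k * a)%:R <= ln (k * a).+1%:R :> R.
      by apply: ler_ln_nat; rewrite ?muln_gt0 ?k0.
    have : ln a.+1%:R <= ln (2 * a)%:R :> R by apply: ler_ln_nat => //; lia.
    by rewrite !ln_natM//; lra.
  rewrite !mulr_sumr; apply: ler_sum_nat => n hn.
  have n0' : 0 < n%:R :> R by rewrite ltr0n; case/andP: hn => + _; apply: leq_trans.
  have n1' : 0 < n.+1%:R :> R by rewrite ltr0n.
  rewrite [X in e * X](_ : _ = n%:R * (n%:R^-1 - n.+1%:R^-1)); last first.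
    by rewrite mulrBr divff ?gt_eqF// -[in n%:R / _](addrK 1 n%:R) natr1 mulrBl
      divff ?gt_eqF// mul1r opprB addrC subrK.
  rewrite mulrA mulrA; apply: ler_wpM2r; last exact/ltW/sg.
  by rewrite subr_ge0 lef_pV2 ?posrE// ler_nat.
have : ln 2 + 43 / e <= ln k%:R by apply: HK; rewrite leq_max leqnn.
move=> hk; have : 43 <= e * (ln k%:R - ln 2).
  by rewrite mulrC -ler_pdivrMr//; lra.
have := ler_norm (s * \sum_(a <= n < k * a) psi_rem R n * (n%:R^-1 - n.+1%:R^-1)).
rewrite normrM s1 mul1r; lra.
Qed.

(** By [psi_rem_short], the remainder stays small on [z, (1 + e) z] when it is small
    at [z]. *)
Lemma psi_rem_small_interval (R : realType) (e : R) : 0 < e ->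
  exists K a0, (0 < K)%N /\ forall a, (a0 <= a)%N ->
    exists2 z, (a <= z < K * a)%N & forall n, (z <= n)%N ->
      n%:R <= (1 + e) * z%:R -> `|psi_rem R n| <= 3 * e * n%:R.
Proof.
move=> e0.
have [K [a0 [K0 a00 H]]] := psi_rem_small_point e0.
have [C C0 HC] := psi_rem_short R.
have [a1 Ha1] := ln_nat_large (1 + C / e).
exists K, (maxn a0 a1); split=> [//|a]; rewrite geq_max => /andP[aa0 aa1].
have [z zK hz] := H a aa0.
exists z => // n zn nz; case/andP: zK => az zK.
have z0 : (0 < z)%N by apply: leq_trans az; apply: leq_trans aa0.
have L : 1 + C / e <= ln n%:R.
  by apply: Ha1; apply: leq_trans zn; apply: leq_trans az.
have Ce : 0 <= C / e by rewrite divr_ge0// ltW.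
have L0 : 0 < ln n%:R :> R by lra.
have := HC z n; rewrite z0 zn => /(_ isT) h.
have Cn : C * n%:R <= e * n%:R * ln n%:R.
  have : C <= e * ln n%:R by rewrite mulrC -ler_pdivrMr//; lra.
  have : 0 <= n%:R :> R by rewrite ler0n.
  by move=> n0 hC; rewrite mulrAC ler_wpM2r.
have {}h : `|psi_rem R n - psi_rem R z| <= (n%:R - z%:R) + e * n%:R.
  by rewrite -(ler_pM2r L0) mulrDl; apply: le_trans h _; rewrite lerD2l.
have := ler_normD (psi_rem R n - psi_rem R z) (psi_rem R z); rewrite subrK.
have zn' : z%:R <= n%:R :> R by rewrite ler_nat.
have : e * z%:R <= e * n%:R by rewrite ler_pM2l.
lra.
Qed.

Lemma ltn_divn_swap (N n k : nat) : (0 < n)%N -> (0 < k)%N ->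
  (N %/ n < k)%N = (N %/ k < n)%N.
Proof. by move=> n0 k0; rewrite !ltn_divLR// mulnC. Qed.

Lemma leq_divn_swap (N n k : nat) : (0 < n)%N -> (0 < k)%N ->
  (k <= N %/ n)%N = (n <= N %/ k)%N.
Proof. by move=> n0 k0; rewrite !leq_divRL// mulnC. Qed.

(** [deficit alpha N u] is what is gained, in the average of
    [psi_rem_average], over the bound [alpha N / n] for the terms [n <= u]. *)
Definition deficit (R : realType) (alpha : R) (N u : nat) : R :=
  \sum_(1 <= n < u.+1) (alpha * (N%:R / n%:R) - `|psi_rem R (N %/ n)|) * ln n%:R.

Lemma deficit_term_ge0 (R : realType) (alpha : R) (n0 N n : nat) :
  0 <= alpha -> (forall m, (n0 <= m)%N -> `|psi_rem R m| <= alpha * m%:R) ->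
  (0 < n)%N -> (n0 <= N %/ n)%N ->
  0 <= (alpha * (N%:R / n%:R) - `|psi_rem R (N %/ n)|) * ln n%:R.
Proof.
move=> al0 H n_gt0 h; rewrite mulr_ge0 ?ln_nat_ge0// subr_ge0.
by apply: le_trans (H _ h) _; rewrite ler_wpM2l// divn_le_div.
Qed.

(** The [n] in [N / (q a), N / a] are those with [N %/ n] in [a, q a], up to rounding.
    Among them, those with [N %/ n] in the interval of [psi_rem_small_interval] have a
    remainder of at most [beta / 2] instead of [alpha], in proportion to [N / n], and
    the sum of [1 / n] over them is bounded below, [P] being large enough for the
    rounding not to matter. Hence a whole block contributes at least [c * N * ln N] to the
    deficit; the last hypothesis makes sure that [ln n >= ln N / 4] in the block. The
    constant [c] depends on [beta] alone, as the iteration in [psi_rem_o] requires. *)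
Lemma deficit_block (R : realType) (beta : R) : 0 < beta <= 1 ->
  exists q a0 P (c : R), [/\ (1 < q)%N, (0 < P)%N, 0 < c &
  forall (alpha : R) n0 a N, beta <= alpha ->
    (forall n, (n0 <= n)%N -> `|psi_rem R n| <= alpha * n%:R) ->
    (0 < a)%N -> (n0 <= a)%N -> (a0 <= a)%N -> (q * a * P <= N)%N ->
    4 * ln (q * a)%:R <= 3 * ln N%:R :> R ->
    deficit alpha N (N %/ (q * a)) + c * (N%:R * ln N%:R) <=
    deficit alpha N (N %/ a)].
Proof.
move=> /andP[b0 b1]; pose e := beta / 6; have e0 : 0 < e by rewrite /e; lra.
have e1 : e <= 1 / 6 by rewrite /e; lra.
have [K [a0 [K0 H]]] := psi_rem_small_interval e0.
(* A lower bound for the sum of [1 / n] over the [n] with [N %/ n] in the interval of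
   ratio [1 + e]; halving [e] absorbs the rounding of the end points. *)
pose c1 : R := ln (1 + e / 2).
have c10 : 0 < c1 by apply: ln_gt0; lra.
exists (3 * K)%N, a0, (Num.truncn (8 / e)).+1, (beta / 8 * c1); split => //.
- lia.
- by rewrite mulr_gt0//; lra.
move=> alpha n0 a N ba Ha a_gt0 n0a a0a qaP hln.
have al0 : 0 < alpha by lra.
have [z /andP[az zK] hz] := H a a0a.
have z0 : (0 < z)%N by apply: leq_trans az.
have z0' : 0 < z%:R :> R by rewrite ltr0n.
have x0 : 0 <= (1 + e) * z%:R by rewrite mulr_ge0//; lra.
(* [n < Y] is [n <= (1 + e) z], in the form that [ltn_divn_swap] needs. *)
pose Y := (Num.truncn ((1 + e) * z%:R)).+1.
have YP n : (n < Y)%N -> n%:R <= (1 + e) * z%:R.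
  rewrite /Y ltnS => h; apply: le_trans (_ : (Num.truncn ((1 + e) * z%:R))%:R <= _).
    by rewrite ler_nat.
  by rewrite truncn_le.
have Y1 : (1 + e) * z%:R < Y%:R by apply: truncnS_gt.
have zY : (z < Y)%N by rewrite -(ltr_nat R); nra.
have Y0 : (0 < Y)%N by [].
clearbody Y.
have Yq : (Y <= 3 * K * a)%N.
  have Y2 : (Y.-1 <= 2 * z)%N.
    rewrite -(ler_nat R) natrM; apply: le_trans (YP Y.-1 _) _; first by rewrite prednK.
    nra.
  by rewrite -mulnA; move: (K * a)%N zK Y2 Y0 z0; clear; lia.
set qa := (3 * K * a)%N in Yq qaP hln *; clearbody qa.
have P0 : 8 / e <= (Num.truncn (8 / e)).+1%:R by apply/ltW/truncnS_gt.
have qa0 : (0 < qa)%N by apply: leq_trans Yq.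
have N0 : (0 < N)%N by apply: leq_trans qaP; rewrite muln_gt0 qa0.
have N0' : 0 < N%:R :> R by rewrite ltr0n.
have Nz : 8 / e <= N%:R / z%:R.
  rewrite ler_pdivlMr//; apply: le_trans (_ : ((Num.truncn (8 / e)).+1 * qa)%:R <= _).
    rewrite natrM; apply: ler_pM => //; first by rewrite divr_ge0// ltW.
    by rewrite ler_nat (leq_trans _ Yq)// ltnW.
  by rewrite ler_nat mulnC.
set A := (N %/ Y)%N; set B := (N %/ z)%N.
set v := (N %/ qa)%N; set u := (N %/ a)%N.
have vA : (v <= A)%N by apply: leq_div2l.
have AB : (A <= B)%N by apply: leq_div2l => //; apply: ltnW.
have Bu : (B <= u)%N by apply: leq_div2l.
have L0 := ln_nat_ge0 R N.
have AN : N%:R < A.+1%:R * Y%:R :> R by rewrite -natrM ltr_nat ltn_ceil.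
have BN : N%:R < B.+1%:R * z%:R :> R by rewrite -natrM ltr_nat ltn_ceil.
have lnA : ln N%:R / 4 <= ln A.+1%:R :> R.
  have : ln N%:R <= ln (A.+1 * Y)%:R :> R.
    by rewrite ler_ln_nat//; rewrite -(ler_nat R) natrM ltW.
  have : ln Y%:R <= ln qa%:R :> R by apply: ler_ln_nat.
  by rewrite (@ln_natM R A.+1 Y)//; lra.
have lnAB : c1 <= ln B.+1%:R - ln A.+1%:R.
  rewrite lerBrDr -lnM ?posrE ?ltr0n//; last by lra.
  rewrite ler_ln ?posrE ?ltr0n//; last by rewrite mulr_gt0 ?ltr0n//; lra.
  set t := N%:R / z%:R in Nz.
  have tB : t < B.+1%:R by rewrite /t ltr_pdivrMr.
  have tA : A%:R * (1 + e) <= t.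
    rewrite /t ler_pdivlMr//; apply: (@le_trans _ _ (A%:R * Y%:R)).
      by rewrite -mulrA ler_wpM2l// ltW.
    by rewrite -natrM ler_nat leq_divM.
  rewrite ler_pdivrMr// in Nz.
  rewrite -[A.+1%:R]natr1.
  have A0 : 0 <= A%:R :> R by rewrite ler0n.
  have : (A%:R + 1) * (1 + e) * (1 + e / 2) <= (t + (1 + e)) * (1 + e / 2).
    by rewrite ler_pM2r; lra.
  have : (t + (1 + e)) * (1 + e / 2) <= t * (1 + e) by nra.
  move=> h1 h2; have {}h1 := le_trans h2 h1.
  have : (1 + e / 2) * (A%:R + 1) <= t.
    by rewrite -(@ler_pM2r _ (1 + e)); lra.
  lra.
have uE : deficit alpha N u = deficit alpha N v +
    \sum_(v.+1 <= n < u.+1)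
      (alpha * (N%:R / n%:R) - `|psi_rem R (N %/ n)|) * ln n%:R.
  by rewrite /deficit (@big_cat_nat _ _ _ v.+1)//= ltnS (leq_trans vA (leq_trans AB Bu)).
rewrite uE lerD2l.
have tge n : (v < n)%N -> (n <= u)%N ->
    0 <= (alpha * (N%:R / n%:R) - `|psi_rem R (N %/ n)|) * ln n%:R.
  move=> vn nu; have n_gt0 : (0 < n)%N by apply: leq_ltn_trans vn.
  apply: (deficit_term_ge0 _ Ha n_gt0); first exact: ltW.
  by apply: (leq_trans n0a); rewrite leq_divn_swap.
rewrite (@big_cat_nat _ _ _ A.+1)//=; last by rewrite ltnS (leq_trans AB).
rewrite [X in _ <= _ + X](@big_cat_nat _ _ _ B.+1)//=.
set S1 := \sum_(_ <= _ < _) _; set S2 := \sum_(_ <= _ < _) _.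
set S3 := \sum_(_ <= _ < _) _.
have S10 : 0 <= S1.
  rewrite /S1 big_nat sumr_ge0// => n /andP[vn nA]; apply: tge => //.
  by apply: leq_trans (leq_trans AB Bu); rewrite -ltnS.
have S30 : 0 <= S3.
  rewrite /S3 big_nat sumr_ge0// => n /andP[vn nA]; apply: tge => //.
  by rewrite (leq_ltn_trans _ vn)// (leq_trans vA).
suff : beta / 8 * c1 * (N%:R * ln N%:R) <= S2 by lra.
apply: (@le_trans _ _ (beta / 2 * N%:R * (ln N%:R / 4) * \sum_(A.+1 <= n < B.+1) n%:R^-1)).
  have := @sum_inv_ge R A.+1 B.+1; rewrite /= ltnS AB => /(_ isT) h.
  have : c1 <= \sum_(A.+1 <= n < B.+1) n%:R^-1 by apply: le_trans h.
  have : 0 <= beta / 2 * N%:R * (ln N%:R / 4).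
    by rewrite !mulr_ge0// ?ltW//; lra.
  set s := \sum_(_ <= _ < _) _ => h1 h2.
  have : beta / 2 * N%:R * (ln N%:R / 4) * c1 <= beta / 2 * N%:R * (ln N%:R / 4) * s.
    by rewrite ler_wpM2l.
  by lra.
rewrite mulr_sumr; apply: ler_sum_nat => n /andP[An nB].
have n_gt0 : (0 < n)%N by apply: leq_ltn_trans An.
have hn : `|psi_rem R (N %/ n)| <= beta / 2 * (N%:R / n%:R).
  apply: (@le_trans _ _ (3 * e * (N %/ n)%:R)).
    apply: hz; first by rewrite leq_divn_swap.
    by apply: YP; rewrite ltn_divn_swap.
  have -> : 3 * e = beta / 2 by rewrite /e; lra.
  by rewrite ler_wpM2l ?divn_le_div//; lra.
have Nn : 0 <= N%:R / n%:R :> R by rewrite divr_ge0.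
have lnn : ln N%:R / 4 <= ln n%:R :> R.
  by apply: le_trans lnA _; apply: ler_ln_nat.
apply: (@le_trans _ _ (beta / 2 * (N%:R / n%:R) * ln n%:R)).
  rewrite [leLHS](_ : _ = beta / 2 * (N%:R / n%:R) * (ln N%:R / 4)); last by ring.
  by rewrite ler_wpM2l// mulr_ge0//; lra.
rewrite ler_wpM2r ?ln_nat_ge0// lerBrDr.
apply: le_trans (lerD (lexx _) hn) _; rewrite -mulrDl ler_wpM2r//; lra.
Qed.

Definition psi_rem_bound (R : realType) (alpha : R) : Prop :=
  exists n0, forall n, (n0 <= n)%N -> `|psi_rem R n| <= alpha * n%:R.

(** Apply [psi_rem_average], splitting its sum at [N / m]. Below, the sum is
    [alpha N sum ln n / n], about [alpha N (ln N)^2 / 2], less the deficit; above, it is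
    [O(N ln N)]. The blocks [a = m q^j] with [q^(2 j) <= N] number about
    [ln N / (2 ln q)], and each adds [c N ln N] to the deficit, which is therefore of
    order [N (ln N)^2] and lowers [alpha] by a constant. *)
Lemma psi_rem_improve (R : realType) (beta : R) : 0 < beta <= 1 ->
  exists2 d : R, 0 < d & forall alpha, beta <= alpha ->
    psi_rem_bound alpha -> psi_rem_bound (alpha - d).
Proof.
move=> b01; have [q [a0 [P [c [q1 P0 c0 Hblock]]]]] := deficit_block b01.
have [C C0 HC] := psi_rem_average R.
have q0 : (0 < q)%N by apply: ltnW.
pose lq : R := ln q%:R.
have lq0 : 0 < lq by apply: ln_gt0; rewrite ltr1n.
have k0 : 0 < c / lq by rewrite divr_gt0.
exists (c / lq / 2); first by lra.
move=> alpha ba [n0 Hn0].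
have al0 : 0 < alpha by case/andP: b01; lra.
pose m := maxn (maxn n0 a0) 1.
have m0 : (0 < m)%N by rewrite leq_max orbT.
have mn0 : (n0 <= m)%N by rewrite !leq_max leqnn.
have ma0 : (a0 <= m)%N by rewrite !leq_max leqnn orbT.
(* The coefficient of the [N * ln N] error terms. *)
pose D : R := alpha + 2 * c + 20 * ln (2 * m)%:R + 2 * C.
have lm0 := ln_nat_ge0 R m; have lP0 := ln_nat_ge0 R P.
have l2m0 := ln_nat_ge0 R (2 * m).
have D0 : 0 <= D by rewrite /D; lra.
have [T TE] : exists T, T = 2 * D / (c / lq) by eexists.
have T0 : 0 <= T by rewrite TE; apply: divr_ge0; [lra|exact: ltW].
have [N1 HN1] := ln_nat_large (1 + 6 * ln m%:R + 2 * ln P%:R + T).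
exists (maxn N1 m) => N; rewrite geq_max => /andP[/HN1 hL mN].
have N0 : (0 < N)%N by apply: leq_trans mN.
have N0' : 0 < N%:R :> R by rewrite ltr0n.
have hD : D <= c / lq / 2 * ln N%:R.
  have : T <= ln N%:R by lra.
  by rewrite TE ler_pdivrMr//; lra.
have {}hL : 1 + 6 * ln m%:R + 2 * ln P%:R <= ln N%:R :> R by lra.
have := HC N N0.
set L : R := ln N%:R in hD hL *.
have L1 : 1 <= L by lra.
pose J := trunc_log (q ^ 2) N.
have q21 : (1 < q ^ 2)%N by rewrite -(exp1n 2) ltn_exp2r.
have qX k : ln ((q ^ 2) ^ k)%:R = 2 * k%:R * lq :> R.
  by rewrite -expnM natrX lnXn ?ltr0n// -[LHS]mulr_natl natrM.
have qX1 k : ln (q ^ k)%:R = k%:R * lq :> R.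
  by rewrite natrX lnXn ?ltr0n// -[LHS]mulr_natl.
have J1 : 2 * J%:R * lq <= L.
  by rewrite -qX; apply: ler_ln_nat; [rewrite !expn_gt0 q0|exact: trunc_logP].
have J2 : L <= 2 * J.+1%:R * lq.
  by rewrite -qX; apply: ler_ln_nat => //; apply/ltnW/trunc_log_ltn.
have blocks j : (j <= J)%N ->
    deficit alpha N (N %/ (m * q ^ j)) + j%:R * (c * (N%:R * L)) <=
    deficit alpha N (N %/ m).
  elim: j => [_|j IH jJ]; first by rewrite expn0 muln1 mul0r addr0.
  apply: le_trans (IH (ltnW jJ)).
  have mq0 : (0 < m * q ^ j)%N by rewrite muln_gt0 m0 expn_gt0 q0.
  have mqm : (m <= m * q ^ j)%N by rewrite leq_pmulr// expn_gt0 q0.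
  have lmq : ln (q * (m * q ^ j))%:R = ln m%:R + j.+1%:R * lq :> R.
    by rewrite mulnCA -expnS ln_natM// ?expn_gt0 ?q0// qX1.
  have jJ' : j.+1%:R * lq <= J%:R * lq by rewrite ler_wpM2r ?ler_nat// ltW.
  have := Hblock alpha n0 (m * q ^ j)%N N ba Hn0 mq0 (leq_trans mn0 mqm)
    (leq_trans ma0 mqm).
  rewrite lmq -/L.
  have -> : (q * (m * q ^ j) = m * q ^ j.+1)%N by rewrite mulnCA -expnS.
  have c1 : (m * q ^ j.+1 * P <= N)%N.
    have mqP : (0 < m * q ^ j.+1 * P)%N by rewrite !muln_gt0 m0 expn_gt0 q0.
    rewrite -(ler_nat R) -ler_ln ?posrE ?ltr0n//.
    rewrite (@ln_natM R (m * q ^ j.+1))// ?muln_gt0 ?m0 ?expn_gt0 ?q0//.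
    by rewrite (@ln_natM R m)// ?expn_gt0 ?q0// qX1 -/L; lra.
  have c2 : 4 * (ln m%:R + j.+1%:R * lq) <= 3 * L by lra.
  move=> /(_ c1 c2); rewrite -[j.+1%:R]natr1; lra.
set u := (N %/ m)%N in blocks.
have u0 : (0 < u)%N by rewrite divn_gt0.
have uN : (u <= N)%N by apply: leq_div.
have J3 : J%:R * (c * (N%:R * L)) <= deficit alpha N u.
  apply: le_trans (blocks J (leqnn J)); rewrite lerDr.
  rewrite /deficit big_nat sumr_ge0// => n /andP[n_gt0 hn].
  apply: (deficit_term_ge0 _ Hn0) => //; first exact: ltW.
  have mq0 : (0 < m * q ^ J)%N by rewrite muln_gt0 m0 expn_gt0 q0.
  apply: (leq_trans mn0); apply: (@leq_trans (m * q ^ J)).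
    by rewrite leq_pmulr// expn_gt0 q0.
  by rewrite leq_divn_swap.
have s1 : \sum_(1 <= n < u.+1) `|psi_rem R (N %/ n)| * ln n%:R <=
    alpha * N%:R * ((L ^+ 2 + L) / 2) - J%:R * (c * (N%:R * L)).
  have -> : \sum_(1 <= n < u.+1) `|psi_rem R (N %/ n)| * ln n%:R =
     alpha * N%:R * (\sum_(1 <= n < u.+1) ln n%:R / n%:R) - deficit alpha N u.
    by rewrite /deficit mulr_sumr -sumrB; apply: eq_bigr => n _; ring.
  apply: lerB => //; apply: ler_wpM2l; first by rewrite mulr_ge0// ltW.
  apply: le_trans (sum_ln_div_le R u0) _.
  have lu0 := ln_nat_ge0 R u.
  have luL : ln u%:R <= L by apply: ler_ln_nat.
  rewrite ler_wpM2r ?invr_ge0// lerD// ler_sqr ?nnegrE//; lra.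
have s2 : \sum_(u.+1 <= n < N.+1) `|psi_rem R (N %/ n)| * ln n%:R <=
    10 * N%:R * L * ln (2 * m)%:R.
  apply: (@le_trans _ _ (10 * N%:R * L * \sum_(u.+1 <= n < N.+1) n%:R^-1)).
    rewrite mulr_sumr; apply: ler_sum_nat => n /andP[un nN].
    have n_gt0 : (0 < n)%N by apply: leq_ltn_trans un.
    rewrite [leRHS](_ : _ = 10 * (N%:R / n%:R) * L); last by ring.
    apply: ler_pM => //; first exact: ln_nat_ge0.
      by apply: le_trans (psi_rem_le R _) _; rewrite ler_wpM2l// divn_le_div.
    exact: ler_ln_nat.
  apply: ler_wpM2l; first by rewrite !mulr_ge0//; lra.
  rewrite big_add1/=; apply: le_trans (sum_inv_le R _) _; first by rewrite u0.
  rewrite lerBlDr -ln_natM ?muln_gt0//; apply: ler_ln_nat => //.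
  have : (N < u.+1 * m)%N by apply: ltn_ceil.
  move: u0 m0; clear; nia.
rewrite (@big_cat_nat _ _ _ u.+1 1%N N.+1)//=.
move=> h.
have L2 : 0 < L ^+ 2 by rewrite exprn_gt0//; lra.
rewrite -(ler_pM2r L2).
have NL : 0 <= N%:R * L by rewrite mulr_ge0//; lra.
have J4 : (L / lq - 2) * (c * (N%:R * L)) <= 2 * J%:R * (c * (N%:R * L)).
  apply: ler_wpM2r; first by rewrite mulr_ge0// ltW.
  have : L / lq <= 2 * J.+1%:R by rewrite ler_pdivrMr.
  by rewrite -[in J.+1%:R]natr1; lra.
have h2 : C * (N%:R * (1 + L)) <= 2 * C * (N%:R * L).
  have : C * (N%:R * (1 + L)) <= C * (N%:R * (L + L)).
    by rewrite ler_wpM2l// ler_wpM2l//; lra.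
  lra.
have h3 : D * (N%:R * L) <= c / lq / 2 * L * (N%:R * L) by rewrite ler_wpM2r.
rewrite /D in h3.
have e1 : (L / lq - 2) * (c * (N%:R * L)) = c / lq * (N%:R * L ^+ 2) - 2 * (c * (N%:R * L)).
  by ring.
have e2 : c / lq / 2 * L * (N%:R * L) = c / lq / 2 * (N%:R * L ^+ 2) by ring.
rewrite e1 in J4; rewrite e2 in h3.
apply: le_trans h _.
move: (c / lq) J4 h3 s1 s2 h2 => kap.
set S1 := \sum_(_ <= _ < _) _; set S2 := \sum_(_ <= _ < _) _.
clear; lra.
Qed.

(** Starting from Chebyshev's bound 10, each application of [psi_rem_improve] lowers the
    bound by the same amount, so it drops below [e] after finitely many. *)
Lemma psi_rem_o (R : realType) (e : R) : 0 < e -> psi_rem_bound e.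
Proof.
move=> e0; pose beta := Num.min e 1.
have b01 : 0 < beta <= 1 by rewrite /beta lt_min e0 ltr01/= ge_min lexx orbT.
have be : beta <= e by rewrite /beta ge_min lexx.
have up (x y : R) : x <= y -> psi_rem_bound x -> psi_rem_bound y.
  move=> xy [n0 H]; exists n0 => n /H/le_trans; apply.
  by rewrite ler_wpM2r.
apply: (up beta) => //.
have [d d0 Hd] := psi_rem_improve b01.
have step k : psi_rem_bound beta \/ psi_rem_bound (10 - k%:R * d).
  elim: k => [|k [IH|IH]]; [|by left|].
    by right; exists 0%N => n _; rewrite mul0r subr0; apply: psi_rem_le.
  have [h|h] := lerP beta (10 - k%:R * d).
    by right; rewrite -[k.+1%:R]natr1 mulrDl mul1r opprD addrA; apply: Hd.
  by left; apply: up IH; apply: ltW.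
have [//|] := step (Num.truncn (10 / d)).+1.
apply: up.
have : 10 / d < (Num.truncn (10 / d)).+1%:R by apply: truncnS_gt.
by rewrite ltr_pdivrMr//; case/andP: b01; lra.
Qed.


(** * From [psi] to the counting function of the primes *)

Lemma size_prime_powers (N p : nat) : prime p ->
  (size [seq n <- index_iota 1 N.+1 | primes n == [:: p]] <= trunc_log p N)%N.
Proof.
move=> pp; have p1 := prime_gt1 pp.
rewrite -[leqRHS](size_iota 1) -[leqRHS](size_map (expn p)).
apply: uniq_leq_size; first by rewrite filter_uniq// iota_uniq.
move=> n; rewrite mem_filter mem_index_iota => /and3P[/eqP E n0 nN].
have [_ nE] := primes_seq1 E.
apply/mapP; exists (logn p n) => //; rewrite mem_iota add1n ltnS.
rewrite logn_gt0 E inE eqxx/=.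
by apply: trunc_log_max => //; rewrite -nE.
Qed.

(** A prime [p] occurs in [psi N] once for each of its powers up to [N], with total
    weight at most [ln N]. *)
Lemma psi_le_primes (R : realType) (N : nat) :
  psi R N <= (count prime (iota 0 N.+1))%:R * ln N%:R.
Proof.
have -> : (count prime (iota 0 N.+1))%:R * ln N%:R =
    \sum_(1 <= p < N.+1 | prime p) ln N%:R :> R.
  rewrite -[iota _ _]/(0%N :: iota 1 N)/= add0n big_const_seq.
  by rewrite /index_iota subn1/= iter_addr_0 mulr_natl.
rewrite /psi.
have -> : \sum_(1 <= n < N.+1) mangoldt R n =
   \sum_(1 <= n < N.+1) \sum_(1 <= p < N.+1 | prime p)
      (if primes n == [:: p] then ln p%:R else 0).
  apply: eq_big_nat => n /andP[n0 nN].
  rewrite /mangoldt; case E: (primes n) => [|p [|p' s]].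
  - by rewrite big1.
  - have [pp _] := primes_seq1 E.
    have pn : (p %| n)%N.
      by have : p \in primes n; [rewrite E inE|rewrite mem_primes => /and3P[]].
    have pN : p \in index_iota 1 N.+1.
      by rewrite mem_index_iota prime_gt0// ltnS (leq_trans (dvdn_leq _ pn)).
    rewrite big_mkcond (bigD1_seq p)//= ?iota_uniq// pp eqxx big1 ?addr0// => r rp.
    by case: ifP => // _; case: eqP => // -[pr]; rewrite pr eqxx in rp.
  - by rewrite big1// => r _; case: eqP.
rewrite exchange_big/=; rewrite big_nat_cond [leRHS]big_nat_cond.
apply: ler_sum => p /andP[/andP[p0 pN] pp].
rewrite -big_mkcond -big_filter big_const_seq count_predT iter_addr_0.
apply: (@le_trans _ _ (ln p%:R *+ trunc_log p N)).
  by apply: ler_wpMn2l; rewrite ?ln_nat_ge0 ?size_prime_powers.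
have N0 : (0 < N)%N by apply: leq_trans p0 _.
rewrite -lnXn ?ltr0n// -natrX; apply: ler_ln_nat; rewrite ?expn_gt0 ?p0//.
exact: trunc_logP (prime_gt1 pp) N0.
Qed.

Lemma sum_indic_le (R : realType) (Y : R) (N : nat) : 0 <= Y ->
  \sum_(1 <= n < N.+1) (n%:R <= Y)%R%:R <= Y.
Proof.
move=> Y0; elim: N => [|N IH]; first by rewrite big_nil.
have [NY|NY] := lerP N.+1%:R Y; last by rewrite big_nat_recr//= (lt_geF NY) addr0.
apply: le_trans NY; apply: le_trans (_ : \sum_(1 <= n < N.+2) 1 <= _).
  by apply: ler_sum => n _; rewrite lern1; case: (_ <= _).
by rewrite sumr_const_nat subn1.
Qed.

(** The primes above [Y] have weight at least [ln Y] in [psi N]. *)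
Lemma primes_le_psi (R : realType) (N : nat) (Y : R) : 1 < Y ->
  (count prime (iota 0 N.+1))%:R <= Y + psi R N / ln Y.
Proof.
move=> Y1; have lY : 0 < ln Y by apply: ln_gt0.
have -> : (count prime (iota 0 N.+1))%:R =
    \sum_(1 <= p < N.+1) (prime p)%:R :> R.
  rewrite -[iota _ _]/(0%N :: iota 1 N)/= add0n -sum1_count natr_sum.
  by rewrite /index_iota subn1/= big_mkcond; apply: eq_bigr => p _; case: prime.
apply: (@le_trans _ _ (\sum_(1 <= n < N.+1) ((n%:R <= Y)%R%:R + mangoldt R n / ln Y))).
  apply: ler_sum_nat => n /andP[n0 nN].
  have L0 : 0 <= mangoldt R n / ln Y by rewrite divr_ge0 ?mangoldt_ge0 ?ltW.
  case: (boolP (prime n)) => pn; last by rewrite addr_ge0.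
  have [nY|nY] := lerP n%:R Y; first by rewrite lerDl.
  rewrite add0r mangoldt_prime// ler_pdivlMr// mul1r ler_ln ?posrE; [exact: ltW|lra|lra].
by rewrite big_split/= -mulr_suml lerD// sum_indic_le//; lra.
Qed.

(** Here [primes_le_psi] is used with [Y = x / (ln x)^2]: this is negligible against
    [x / ln x], while [ln Y] is asymptotic to [ln x]. *)
Lemma prime_pi_approx (R : realType) (e : R) : 0 < e ->
  exists X : R, forall x, X <= x -> `|1 - (prime_pi x)%:R / (x / ln x)| <= e.
Proof.
move=> e0; pose d := Num.min e 1 / 8.
have m0 : 0 < Num.min e 1 by rewrite lt_min e0 ltr01.
have m1 : Num.min e 1 <= 1 by rewrite ge_min lexx orbT.
have me : Num.min e 1 <= e by rewrite ge_min lexx.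
have d0 : 0 < d by rewrite /d; lra.
have d1 : d <= 1 / 8 by rewrite /d; lra.
have de : 8 * d <= e by rewrite /d; lra.
clearbody d => {m0 m1 me}.
have [n0 Hn0] := psi_rem_o d0.
have [Z Z0 HZ] : exists2 Z : R, 0 < Z & forall x, Z <= x -> ln x <= d / 2 * x.
  by apply: ln_le_eps; lra.
exists (1 + n0%:R + d^-1 + expR (Z + d^-1)) => x hx.
have di0 : 0 < d^-1 by rewrite invr_gt0.
have n00 : 0 <= n0%:R :> R by [].
have E0 := expR_gt0 (Z + d^-1).
have x1 : 1 < x by lra.
have x0 : 0 < x by lra.
rewrite prime_piE; set N := Num.truncn x.
have /andP[Nx xN] : N%:R <= x < N.+1%:R by apply: truncn_itv; apply: ltW.
have N0 : (0 < N)%N by rewrite truncn_ge_nat ?ltW//.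
have hN : (n0 <= N)%N by rewrite truncn_ge_nat ?ltW//; lra.
have hL : Z + d^-1 <= ln x by rewrite -[leLHS]expRK ler_ln ?posrE//; lra.
set L := ln x in hL *.
have L0 : 0 < L by lra.
have dL : 1 <= d * L by rewrite mulrC -ler_pdivrMr// mul1r; lra.
have dx : 1 <= d * x by rewrite mulrC -ler_pdivrMr// mul1r; lra.
set p : R := (count prime (iota 0 N.+1))%:R.
have p0 : 0 <= p by rewrite /p ler0n.
have /andP[r1 r2] : (1 - d) * N%:R <= psi R N <= (1 + d) * N%:R.
  by have := Hn0 N hN; rewrite /psi_rem ler_norml; lra.
have low : psi R N <= p * L.
  apply: le_trans (psi_le_primes R N) _; rewrite ler_wpM2l//.
  by rewrite ler_ln ?posrE ?ltr0n.
pose Y := x / L ^+ 2.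
have Y0 : 0 < Y by rewrite divr_gt0// exprn_gt0.
have lY : (1 - d) * L <= ln Y.
  rewrite /Y ln_div ?posrE ?exprn_gt0// lnXn// -/L.
  have := HZ L; rewrite -mulr_natl => /(_ _); lra.
have lY0 : 0 < ln Y by apply: lt_le_trans lY; rewrite mulr_gt0//; lra.
have Y1 : 1 < Y by rewrite ltNge; apply/negP => /ln_le0; rewrite leNgt lY0.
have up : p * L <= d * x + (1 + 4 * d) * x.
  have := primes_le_psi N Y1; rewrite -/p => hp.
  have {}hp : p * L <= Y * L + psi R N / ln Y * L.
    by rewrite -mulrDl ler_wpM2r// ltW.
  apply: le_trans hp _; apply: lerD.
    rewrite /Y expr2 invfM mulrA -mulrA mulVf ?gt_eqF// mulr1.
    by rewrite ler_pdivrMr// mulrAC ler_peMl// ltW.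
  rewrite mulrAC ler_pdivrMr//.
  have : (1 + 4 * d) * x * ((1 - d) * L) <= (1 + 4 * d) * x * ln Y.
    by rewrite ler_wpM2l// mulr_ge0//; lra.
  move=> h; apply: (le_trans _ h); rewrite mulrA.
  apply: ler_wpM2r; first exact: ltW.
  apply: le_trans r2 _; nra.
have -> : p / (x / L) = p * L / x by rewrite invf_div mulrA.
have xi : 0 < x^-1 by rewrite invr_gt0.
have lo2 : (1 - 2 * d) * x <= p * L.
  apply: (le_trans _ low); apply: (le_trans _ r1); move: xN; rewrite -natr1; nra.
rewrite ler_norml; apply/andP; split.
  by rewrite lerBrDr -lerBrDl ler_pdivrMr//; nra.
by rewrite lerBlDr -lerBlDl ler_pdivlMr//; nra.
Qed.

Unset Implicit Arguments.

Theorem theorem2p2 (R : realType) :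
  (prime_pi x)%:R / (x / ln x) @[x --> (+oo : set_system R)] --> (1 : R).
Proof.
apply/cvgrPdist_le => e e0; have [X HX] := prime_pi_approx e0.
near=> x; apply: HX; near: x.
by apply: nbhs_pinfty_ge; exact: num_real.
Unshelve. all: by end_near. Qed.
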